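(* Let $\mathcal V$ be a class of valuations closed under non-negative scaling, disjoint union, and item truncation, and suppose that $(v,w)$ is query-sufficient for $IT(v,w)$ whenever $v,w\in\mathcal V$. Let $A$ be an $\alpha$-approximation algorithm for $\mathsf{MDMDP}(\mathcal V)$ using either value oracles or explicit input. Then for any integer $k\ge 2$, given black-box access to $A$, there is a $\mathrm{poly}(km)$-time algorithm for $\mathsf{ODP}(\mathcal V)$ (on inputs with $m$ items) making a single black-box call to $A$ plus an additional $\mathrm{poly}(km)$ value queries to the $\mathsf{ODP}$ input, with the following properties: (Quality) On $\mathsf{ODP}$ input $(v,w)$, the algorithm produces an $\left(\alpha-\frac{(1-\alpha)\,2m\,w([m])}{k-1}\right)$-approximation. (Complexity) Each valuation $v_\ell(\cdot)$ input to $A$ takes as input subsets of $[(k-1)m]$ and satisfies $v_\ell([(k-1)m])\le (2k\max\{v([m]),w([m])\})^k$. Moreover, all probabilities input to $A$ can be written as the ratio of two integers at most $(2k\max\{v([m]),w([m])\})^{2k}$.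
   Context: Valuations: a valuation on a finite item set (base set $[m]$) is a function $v$ from subsets of items to $\mathbb{N}$ with $v(\emptyset)=0$, monotone ($v(S\cup T)\ge v(S)$), and without trivial items ($v(S)>0$ for $S\neq\emptyset$). If $S$ is a random set, $v(S)$ denotes $\mathbb{E}[v(S)]$. A class $\mathcal V$ contains valuations on item sets of any finite size. Problem $\mathsf{MDMDP}(\mathcal V)$. Input: an explicit distribution $D$ over finitely many valuations in $\mathcal V$ (list of valuations with probabilities). Output: for each $v$ in the support, a (possibly randomized) set $S_v$ and a price $p_v$ such that $v(S_v)-p_v\ge v(S_w)-p_w$ for all $v,w$ in the support; not participating is always available (the set $\emptyset$ at price $0$), i.e. also $v(S_v)-p_v\ge0$. Objective: maximize $\sum_v\Pr[v\leftarrow D]p_v$. An output is an $\alpha$-approximation if $\sum_v\Pr[v\leftarrow D]p_v\ge\alpha\cdot\mathrm{OPT}$. Problem $\mathsf{ODP}(\mathcal V)$. Input: $v,w\in\mathcal V$ on $[m]$. Output: a (possibly randomized) set $S$. Objective: maximize $v(S)-w(S)$. $S$ is an $\alpha$-approximation if $v(S)-w(S)\ge\alpha\cdot\max_T\{v(T)-w(T)\}$. Input models: value oracle (black box returning $v(S)$ on query $S$) or explicit input (a circuit or Turing machine computing $v(S)$, of polynomial size/runtime). Disjoint union of $v,w$ (each on items $M$): the valuation $z(S)=v(S\cap M_1)+w(S\cap M_2)$ on two disjoint copies $M_1\sqcup M_2$ of $M$. Item truncation of $u$ at $y$: $u'(S)=\max_{T\subseteq S,\,|T|\le y}u(T)$;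 closed under item truncation means closed for every $y$. The list $IT(v,w)$ (with parameter $k$): take $k-1$ disjoint copies $M_1,\dots,M_{k-1}$ of the $m$ items, and for $S\subseteq\bigsqcup_i M_i$ let $S_i=S\cap M_i$. For $\ell\in[k]$ let $u_\ell(S)=\sum_{i\ge\ell}(k+i)v(S_i)+\sum_{i<\ell}(k+i)w(S_i)$ (with $1\le i\le k-1$). $IT(v,w)$ is the list $(v_1,\dots,v_k)$ where $v_\ell(S)=\max_{T\subseteq S,|T|\le m}u_\ell(T)$ is $u_\ell$ item-truncated at $m$. A list $V$ of valuations is query-sufficient for a list $W$ if (a) value queries to every function in $W$ can be executed using polynomially many value queries to functions in $V$, and (b) succinct (polynomial size/runtime) circuits/Turing machines computing value queries for every function in $W$ can be written using succinct circuits/Turing machines computing value queries for every function in $V$.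
   Formalization: Closure under disjoint union is assumed also for valuations on item sets of different sizes (k−1 copies are otherwise unreachable); query-sufficiency is taken as uniform over the class and in polynomial time; m is at least 1. *)

(* Defs.v *)
From mathcomp Require Import all_boot all_order all_algebra.
From mathcomp Require Import boolp classical_sets reals.
Set Implicit Arguments.
Unset Strict Implicit.
Unset Printing Implicit Defensive.
Import Order.TTheory GRing.Theory Num.Theory.

(** * Valuations *)

(* The item set [n] is 'I_n. *)
Definition valn (n : nat) := {ffun {set 'I_n} -> nat}.

Definition is_valuation n (v : valn n) : Prop :=
  [/\ v finset.set0 = 0,
      forall S T, v S <= v (S :|: T)
    & forall S, S != finset.set0 -> 0 < v S].

Definition val_class := forall n, valn n -> Prop.

Definition valuation_class (V : val_class) : Prop :=
  forall n (v : valn n), V n v -> is_valuation v.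

(* The factor may be any non-negative rational, but the scaled function has to be a
   valuation again: this rules out non-integral values and c = 0. *)
Definition closed_scaling (V : val_class) : Prop :=
  forall n (v v' : valn n) (c : rat), (0 <= c)%R -> V n v ->
    (forall S, (v' S)%:R = c * (v S)%:R :> rat)%R -> is_valuation v' -> V n v'.

Definition dunion n1 n2 (v : valn n1) (w : valn n2) : valn (n1 + n2) :=
  [ffun S : {set 'I_(n1 + n2)} =>
     v [set i | lshift n2 i \in S] + w [set i | rshift n1 i \in S]].

Definition closed_dunion (V : val_class) : Prop :=
  forall n1 n2 (v : valn n1) (w : valn n2),
    V n1 v -> V n2 w -> V (n1 + n2) (dunion v w).

Definition item_trunc n (y : nat) (u : valn n) : valn n :=
  [ffun S : {set 'I_n} =>
     \max_(T : {set 'I_n} | (T \subset S) && (#|T| <= y)) u T].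

(* Truncating at y = 0 makes every item trivial, hence the side condition. *)
Definition closed_truncation (V : val_class) : Prop :=
  forall n (v : valn n) (y : nat),
    V n v -> is_valuation (item_trunc y v) -> V n (item_trunc y v).

(** * The list IT(v, w) *)

(* Item j of the copy number i (counted from 0) is the item i * m + j. *)
Definition copy_of k m (S : {set 'I_(k.-1 * m)}) (i : 'I_k.-1) : {set 'I_m} :=
  [set j : 'I_m | [exists x in S, x == i * m + j :> nat]].

(* Copies and list entries are numbered from 0, so that the coefficient of the
   copy i is k + i.+1, and the condition comparing i and l is unchanged. *)
Definition IT_sum k m (v w : valn m) (l : 'I_k) : valn (k.-1 * m) :=
  [ffun S : {set 'I_(k.-1 * m)} =>
     \sum_(i < k.-1)
       (k + i.+1) * (if l <= i then v (copy_of S i) else w (copy_of S i))].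

Definition IT k m (v w : valn m) (l : 'I_k) : valn (k.-1 * m) :=
  item_trunc m (IT_sum v w l).

(** * Single-bidder multi-dimensional mechanism design, and differences *)

Section Problems.
Variable R : realType.
Local Open Scope ring_scope.

Definition is_dist (T : finType) (p : T -> R) : Prop :=
  (forall x, 0 <= p x) /\ \sum_x p x = 1.

Definition ev n (v : valn n) (p : {set 'I_n} -> R) : R :=
  \sum_S p S * (v S)%:R.

Record menu (n k : nat) := Menu {
  alloc : 'I_k -> {set 'I_n} -> R;
  price : 'I_k -> R }.

Definition feasible n k (z : {ffun 'I_k -> valn n}) (M : menu n k) : Prop :=
  [/\ forall l, is_dist (alloc M l),
      forall l j, ev (z l) (alloc M j) - price M j
                  <= ev (z l) (alloc M l) - price M l
    & forall l, 0 <= ev (z l) (alloc M l) - price M l].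

Definition revenue n k (q : {ffun 'I_k -> rat}) (M : menu n k) : R :=
  \sum_l ratr (q l) * price M l.

Definition OPT n k (z : {ffun 'I_k -> valn n}) (q : {ffun 'I_k -> rat}) : R :=
  sup [set revenue q M | M in feasible z]%classic.

Definition mdmdp_approx n k (alpha : R) (z : {ffun 'I_k -> valn n})
    (q : {ffun 'I_k -> rat}) (M : menu n k) : Prop :=
  feasible z M /\ alpha * OPT z q <= revenue q M.

(* The list z enumerates the support, without repetition. *)
Definition valid_input (V : val_class) n k (z : {ffun 'I_k -> valn n})
    (q : {ffun 'I_k -> rat}) : Prop :=
  [/\ forall l, V n (z l), injective z, forall l, 0 < q l & \sum_l q l = 1].

(* The index 0 of the maximum is the value at the empty set. *)
Definition odp_opt m (v w : valn m) : R :=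
  \big[Num.max/0]_(T : {set 'I_m}) ((v T)%:R - (w T)%:R).

Definition odp_approx m (beta : R) (v w : valn m) (p : {set 'I_m} -> R) : Prop :=
  is_dist p /\ beta * odp_opt v w <= ev v p - ev w p.

(* Law of f applied to independent draws of the k sets offered by a menu. *)
Definition output_dist n k m (M : menu n k)
    (f : {ffun 'I_k -> {set 'I_n}} -> {set 'I_m}) (T : {set 'I_m}) : R :=
  \sum_(omega | f omega == T) \prod_l alloc M l (omega l).

End Problems.

(** * Model of computation *)

(* Programs map trees with natural-number leaves to such trees, and may query
   oracles.  Loops have a precomputed number of rounds: this makes the
   semantics total and loses no polynomial-time algorithm, which can always be
   run under a polynomial clock. *)
Inductive tree := Leaf of nat | Node of tree & tree.

Definition tnum (x : tree) : nat := if x is Leaf n then n else 0.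
Definition tfst (x : tree) : tree := if x is Node y _ then y else Leaf 0.
Definition tsnd (x : tree) : tree := if x is Node _ y then y else Leaf 0.

Inductive arith := Add | Sub | Mul | Div | Leq.

Definition arith_op (o : arith) : nat -> nat -> nat :=
  match o with
  | Add => addn | Sub => subn | Mul => muln | Div => divn
  | Leq => fun a b => a <= b
  end.

Inductive prog :=
| Arg
| Lit of nat
| Pair of prog & prog
| Fst of prog
| Snd of prog
| IsPair of prog
| Op of arith & prog & prog
| Cond of prog & prog & prog
| Comp of prog & prog          (* Comp f p: f on the result of p *)
| Iter of prog & prog & prog   (* Iter p q f: f iterated p times from q *)
| Query of nat & prog.

(* Arithmetic operations count as single steps, so the bit length of the
   largest number handled is recorded separately in [width]. *)
Record outcome := Outcome {
  res : tree; steps : nat; queries : nat; width : nat }.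

Definition nbits (n : nat) : nat := (trunc_log 2 n).+1.
Definition bits (x : tree) : nat := if x is Leaf n then nbits n else 0.

Definition emit (r : tree) (os : seq outcome) : outcome :=
  Outcome r (sumn (map steps os)).+1 (sumn (map queries os))
    (foldr maxn (bits r) (map width os)).

Definition oracle := nat -> tree -> nat.

Fixpoint run (orc : oracle) (p : prog) (x : tree) : outcome :=
  match p with
  | Arg => emit x [::]
  | Lit n => emit (Leaf n) [::]
  | Pair p q =>
      let o1 := run orc p x in let o2 := run orc q x in
      emit (Node (res o1) (res o2)) [:: o1; o2]
  | Fst p => let o := run orc p x in emit (tfst (res o)) [:: o]
  | Snd p => let o := run orc p x in emit (tsnd (res o)) [:: o]
  | IsPair p =>
      let o := run orc p x in
      emit (Leaf (if res o is Node _ _ then 1 else 0)) [:: o]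
  | Op a p q =>
      let o1 := run orc p x in let o2 := run orc q x in
      emit (Leaf (arith_op a (tnum (res o1)) (tnum (res o2)))) [:: o1; o2]
  | Cond p q r =>
      let o1 := run orc p x in
      let o2 := if tnum (res o1) != 0 then run orc q x else run orc r x in
      emit (res o2) [:: o1; o2]
  | Comp f p =>
      let o1 := run orc p x in let o2 := run orc f (res o1) in
      emit (res o2) [:: o1; o2]
  | Iter p q f =>
      let o1 := run orc p x in
      let round o := let o' := run orc f (res o) in emit (res o') [:: o; o'] in
      let o2 := iter (tnum (res o1)) round (run orc q x) in
      emit (res o2) [:: o1; o2]
  | Query i p =>
      let o := run orc p x in
      let o' := emit (Leaf (orc i (res o))) [:: o] in
      Outcome (res o') (steps o') (queries o').+1 (width o')
  end.

Definition enc_seq (s : seq tree) : tree := foldr Node (Leaf 0) s.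

Definition enc_set n (S : {set 'I_n}) : tree :=
  enc_seq [seq Leaf (i \in S) | i <- enum 'I_n].

Definition dec_set n (x : tree) : {set 'I_n} :=
  [set i : 'I_n | tnum (tfst (iter i tsnd x)) != 0].

Lemma enc_setK n : cancel (@enc_set n) (@dec_set n).
Proof.
move=> S; apply/setP=> i; rewrite inE.
have nthE (s : seq tree) j : tfst (iter j tsnd (enc_seq s)) = nth (Leaf 0) s j.
  elim: j s => [|j IH] [|y s] //=; last by rewrite -iterS iterSr IH.
  by rewrite -iterS iterSr /= -[Leaf 0]/(enc_seq [::]) IH nth_nil.
by rewrite nthE (nth_map i) ?size_enum_ord // nth_ord_enum; case: (i \in S).
Qed.

(* Value queries to the pair (v, w). *)
Definition oracles m (v w : valn m) : oracle :=
  fun i x => if i == 0 then v (dec_set m x) else w (dec_set m x).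

Definition no_oracle : oracle := fun _ _ => 0.

Definition arith_code (o : arith) : nat :=
  match o with Add => 0 | Sub => 1 | Mul => 2 | Div => 3 | Leq => 4 end.

Fixpoint quote (p : prog) : tree :=
  match p with
  | Arg => enc_seq [:: Leaf 0]
  | Lit n => enc_seq [:: Leaf 1; Leaf n]
  | Pair p q => enc_seq [:: Leaf 2; quote p; quote q]
  | Fst p => enc_seq [:: Leaf 3; quote p]
  | Snd p => enc_seq [:: Leaf 4; quote p]
  | IsPair p => enc_seq [:: Leaf 5; quote p]
  | Op a p q => enc_seq [:: Leaf 6; Leaf (arith_code a); quote p; quote q]
  | Cond p q r => enc_seq [:: Leaf 7; quote p; quote q; quote r]
  | Comp f p => enc_seq [:: Leaf 8; quote f; quote p]
  | Iter p q f => enc_seq [:: Leaf 9; quote p; quote q; quote f]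
  | Query i p => enc_seq [:: Leaf 10; Leaf i; quote p]
  end.

Fixpoint psize (p : prog) : nat :=
  match p with
  | Arg => 1
  | Lit n => 1 + nbits n
  | Pair p q | Op _ p q | Comp p q => 1 + psize p + psize q
  | Fst p | Snd p | IsPair p => 1 + psize p
  | Cond p q r | Iter p q r => 1 + psize p + psize q + psize r
  | Query i p => 1 + nbits i + psize p
  end.

(* d is the code of a program of size at most s that computes v within s steps
   on numbers of at most s bits. *)
Definition computes n (d : tree) (v : valn n) (s : nat) : Prop :=
  exists p : prog, [/\ d = quote p, psize p <= s &
    forall S : {set 'I_n}, let o := run no_oracle p (enc_set S) in
      [/\ res o = Leaf (v S), steps o <= s & width o <= s]].

(** * Polynomial time *)

Definition poly_bound (c x : nat) : nat := c * x.+1 ^ c.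

Definition budget (o : outcome) (t b : nat) : Prop :=
  [/\ steps o <= t, queries o <= t & width o <= b].

Definition vmax m (v w : valn m) : nat := maxn (v [set: 'I_m]) (w [set: 'I_m]).

(* Strongly polynomial time: poly(km) steps and queries, on numbers whose bit
   length exceeds that of the values of v and w by a factor poly(km) at most. *)
Definition oracle_time c k m (v w : valn m) (o : outcome) : Prop :=
  budget o (poly_bound c (k * m)) (poly_bound c (k * m) * nbits (vmax v w)).

(* s bounds the size and the running time of the explicit input. *)
Definition explicit_time c k m s (o : outcome) : Prop :=
  budget o (poly_bound c (k * m * s)) (poly_bound c (k * m * s)).

(** * Query sufficiency of (v, w) for IT(v, w), uniformly over a class *)

Definition query_simulation (V : val_class) : Prop :=
  exists (c : nat) (p : prog), forall (k m : nat) (v w : valn m),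
    1 < k -> 0 < m -> V m v -> V m w ->
    forall (l : 'I_k) (S : {set 'I_(k.-1 * m)}),
      let o := run (oracles v w) p
                 (enc_seq [:: Leaf k; Leaf m; Leaf l; enc_set S]) in
      res o = Leaf (IT v w l S) /\ oracle_time c k v w o.

(* A code can be evaluated, so value queries are allowed when writing codes. *)
Definition code_writing (V : val_class) : Prop :=
  exists (c : nat) (p : prog),
    forall (k m s : nat) (v w : valn m) (dv dw : tree),
    1 < k -> 0 < m -> V m v -> V m w ->
    computes dv v s -> computes dw w s ->
    let o := run (oracles v w) p (enc_seq [:: Leaf k; Leaf m; dv; dw]) in
    explicit_time c k m s o /\
    exists d : 'I_k -> tree,
      res o = enc_seq [seq d l | l <- enum 'I_k] /\
      forall l, computes (d l) (IT v w l) (poly_bound c (k * m * s)).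

Definition query_sufficient (V : val_class) : Prop :=
  query_simulation V /\ code_writing V.

(** * Algorithms for MDMDP(V), as black boxes *)

Definition oracle_solver (R : realType) :=
  forall n k, {ffun 'I_k -> valn n} -> {ffun 'I_k -> rat} -> menu R n k.

Definition oracle_approx (R : realType) (V : val_class) (alpha : R)
    (A : oracle_solver R) : Prop :=
  forall n k (z : {ffun 'I_k -> valn n}) (q : {ffun 'I_k -> rat}),
    valid_input V z q -> mdmdp_approx alpha z q (A n k z q).

(* With explicit input the answer may depend on the codes. *)
Definition explicit_solver (R : realType) :=
  forall n k, {ffun 'I_k -> tree} -> {ffun 'I_k -> rat} -> menu R n k.

Definition explicit_approx (R : realType) (V : val_class) (alpha : R)
    (A : explicit_solver R) : Prop :=
  forall n k (z : {ffun 'I_k -> valn n}) (d : {ffun 'I_k -> tree})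
    (q : {ffun 'I_k -> rat}),
    valid_input V z q -> (forall l, exists s, computes (d l) (z l) s) ->
    mdmdp_approx alpha z q (A n k d q).

(** * Reductions from ODP(V) making a single call *)

Definition ratios k (a b : 'I_k -> nat) : {ffun 'I_k -> rat} :=
  [ffun l => ((a l)%:R / (b l)%:R)%R].

Definition enc_ratios k (a b : 'I_k -> nat) : tree :=
  enc_seq [seq Node (Leaf (a l)) (Leaf (b l)) | l <- enum 'I_k].

Definition enc_draws n k (omega : {ffun 'I_k -> {set 'I_n}}) : tree :=
  enc_seq [seq enc_set (omega l) | l <- enum 'I_k].

Definition input_bounds k m (v w : valn m)
    (z : {ffun 'I_k -> valn (k.-1 * m)}) (a b : 'I_k -> nat) : Prop :=
  (forall l, z l [set: 'I_(k.-1 * m)] <= (2 * k * vmax v w) ^ k) /\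
  (forall l, a l <= (2 * k * vmax v w) ^ (2 * k) /\
             b l <= (2 * k * vmax v w) ^ (2 * k)).

Definition quality (R : realType) (alpha : R) k m (w : valn m) : R :=
  (alpha - (1 - alpha) * 2 * m%:R * (w [set: 'I_m])%:R / (k%:R - 1))%R.

(* pre prepares the call, starting its result with the k probabilities; post
   is then given one draw of each of the k sets returned by the call (and no
   price), and computes a set.  x is the input of the reduction. *)
Definition finish n k (orc : oracle) (post : prog) (x y : tree)
    (omega : {ffun 'I_k -> {set 'I_n}}) : outcome :=
  run orc post (enc_seq [:: x; y; enc_draws omega]).

(* With value oracles, ora answers the value queries of the called algorithm
   to its l-th valuation. *)
Definition oracle_reduction (R : realType) (V : val_class) (c : nat)
    (pre ora post : prog) (alpha : R) (A : oracle_solver R)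
    k m (v w : valn m) : Prop :=
  let orc := oracles v w in
  let x := enc_seq [:: Leaf k; Leaf m] in
  let y := res (run orc pre x) in
  oracle_time c k v w (run orc pre x) /\
  exists (z : {ffun 'I_k -> valn (k.-1 * m)}) (a b : 'I_k -> nat),
    [/\ tfst y = enc_ratios a b,
        forall (l : 'I_k) (S : {set 'I_(k.-1 * m)}),
          let o := run orc ora (enc_seq [:: x; y; Leaf l; enc_set S]) in
          res o = Leaf (z l S) /\ oracle_time c k v w o,
        valid_input V z (ratios a b),
        input_bounds v w z a b
      & (forall omega : {ffun 'I_k -> {set 'I_(k.-1 * m)}},
           oracle_time c k v w (finish orc post x y omega)) /\
        odp_approx (quality alpha k w) v w
          (output_dist (A (k.-1 * m) k z (ratios a b))
             (fun omega => dec_set m (res (finish orc post x y omega))))].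

(* With explicit input, pre also writes the codes passed to the algorithm. *)
Definition explicit_reduction (R : realType) (V : val_class) (c : nat)
    (pre post : prog) (alpha : R) (A : explicit_solver R)
    k m s (v w : valn m) (dv dw : tree) : Prop :=
  let orc := oracles v w in
  let x := enc_seq [:: Leaf k; Leaf m; dv; dw] in
  let y := res (run orc pre x) in
  explicit_time c k m s (run orc pre x) /\
  exists (z : {ffun 'I_k -> valn (k.-1 * m)}) (d : {ffun 'I_k -> tree})
      (a b : 'I_k -> nat),
    [/\ tfst y = enc_ratios a b /\
        tfst (tsnd y) = enc_seq [seq d l | l <- enum 'I_k],
        forall l, computes (d l) (z l) (poly_bound c (k * m * s)),
        valid_input V z (ratios a b),
        input_bounds v w z a b
      & (forall omega : {ffun 'I_k -> {set 'I_(k.-1 * m)}},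
           explicit_time c k m s (finish orc post x y omega)) /\
        odp_approx (quality alpha k w) v w
          (output_dist (A (k.-1 * m) k d (ratios a b))
             (fun omega => dec_set m (res (finish orc post x y omega))))].

(* Main.v *)
(**
  Let v_0, ..., v_(k-1) be the list IT(v, w), numbered from 0, let
  c_l = k + l + 1, and let OPT' = max_T (v(T) - w(T)).  The called algorithm
  gets the types z_l = C_l v_l with C_0 = 1 and C_(l+1) = 2 V (2 k V)^l, where
  V = max(v([m]), w([m])), and the probabilities are chosen such that type l or
  higher is drawn with probability 1 / C_l.  Bounding the price of type l + 1 by
  its constraint against type l, summation by parts shows that every menu (S_l)
  has revenue at most
    sum_(l < k-1) (v_l(S_l) - v_(l+1)(S_l)) + v_(k-1)([(k-1)m]).
  Truncation is harmless: if S' is a minimal subset of S with v_l(S') = v_l(S),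
  then S' has at most m items and is not truncated, whence
    v_l(S) - v_(l+1)(S) <= c_l (v(T) - w(T))
  for the part T of S' in copy l.  Greedy deletion finds S' by value queries.
  So the l-th term is at most c_l OPT' on the one hand, and c_l times the value
  of a candidate set that the reduction can compute on the other hand; the
  reduction returns the best candidate.
  Conversely, offering to type l < k-1 an optimal T in copy l, and everything to
  type k-1, attains the revenue sum_l c_l OPT' + v_(k-1)([(k-1)m]), as C_l grows
  fast enough for the local incentive constraints to imply the others.  Finally
  v_(k-1)([(k-1)m]) <= 2 k m w([m]), while sum_l c_l >= (k-1) k, and OPT' >= 1
  unless OPT' = 0.
*)

Require Import Defs.
From mathcomp Require Import all_boot all_order all_algebra.
From mathcomp Require Import boolp classical_sets reals.
From mathcomp Require Import zify ring lra.

Set Implicit Arguments.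
Unset Strict Implicit.
Unset Printing Implicit Defensive.
Import Order.TTheory GRing.Theory Num.Theory.

(** * Cost of programs *)

Lemma nbits_leq a b : a <= b -> nbits a <= nbits b.
Proof. by move=> ab; rewrite /nbits ltnS leq_trunc_log. Qed.

Lemma nbits_bounds n : 2 ^ (nbits n).-1 <= maxn 1 n /\ n < 2 ^ nbits n.
Proof.
rewrite /nbits /=; case: n => [|n]; first by rewrite trunc_log0.
by split; [apply: leq_trans (leq_maxr _ _); rewrite trunc_logP | rewrite trunc_log_ltn].
Qed.

Lemma nbits_le_of n s : 0 < s -> n < 2 ^ s -> nbits n <= s.
Proof.
move=> s0 ns; have [h _] := nbits_bounds n.
have : 2 ^ (nbits n).-1 < 2 ^ s.
  by apply: leq_ltn_trans h _; rewrite gtn_max ns andbT -{1}(expn0 2) ltn_exp2l.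
by rewrite ltn_exp2l // /nbits.
Qed.

Lemma nbits_le n : nbits n <= n.+1.
Proof. by apply: nbits_le_of => //; apply: ltnW; rewrite ltn_expl. Qed.

Lemma nbits_add a b : nbits (a + b) <= (nbits a + nbits b).+1.
Proof.
have [_ ha] := nbits_bounds a; have [_ hb] := nbits_bounds b.
apply: nbits_le_of => //; rewrite expnS expnD.
by move: (2 ^ _) (2 ^ _) ha hb => x y; nia.
Qed.

Lemma nbits_mul a b : nbits (a * b) <= nbits a + nbits b.
Proof.
have [_ ha] := nbits_bounds a; have [_ hb] := nbits_bounds b.
by apply: nbits_le_of => //; rewrite expnD ltn_mul.
Qed.

Lemma nbits_exp a n : nbits (a ^ n) <= (n * nbits a).+1.
Proof.
have [_ ha] := nbits_bounds a.
apply: nbits_le_of => //; rewrite mulnC expnS expnM.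
have : a ^ n <= (2 ^ nbits a) ^ n by case: n => // n; rewrite leq_exp2r // ltnW.
have : 0 < (2 ^ nbits a) ^ n by rewrite expn_gt0 expn_gt0.
lia.
Qed.

Lemma nbits_arith o a b : nbits (arith_op o a b) <= (nbits a + nbits b).+1.
Proof.
case: o => /=.
- exact: nbits_add.
- by apply: leq_trans (nbits_leq (leq_subr b a)) _; lia.
- by apply: leq_trans (nbits_mul a b) _; lia.
- by apply: leq_trans (nbits_leq (leq_div a b)) _; lia.
- by apply: leq_trans (nbits_leq (leq_b1 _)) _.
Qed.

(* All bounds are expressed as powers of [base]: constant factors and finite
   sums are absorbed by increasing the exponent, as the base is at least 3. *)
Record setting := Setting {
  orc : oracle;
  base : nat;
  wid : nat;
  base_gt2 : 2 < base;
  wid_gt0 : 0 < wid;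
  orc_wid : forall i x, nbits (orc i x) <= wid }.

Definition cost e c (o : outcome) : Prop :=
  [/\ steps o <= base e ^ c, queries o <= base e ^ c
    & width o <= base e ^ c * wid e].

(** [width] counts only results that are single leaves, so a number inside a pair goes unnoticed
    until it is projected out. Bounding all leaves of a tree makes projections harmless. *)
Fixpoint deep e c (t : tree) : bool :=
  match t with
  | Leaf n => nbits n <= base e ^ c * wid e
  | Node a b => deep e c a && deep e c b
  end.

Definition exec e c (p : prog) (x r : tree) : Prop :=
  [/\ res (run (orc e) p x) = r, cost e c (run (orc e) p x) & deep e c r].

Lemma base_expS e c : 3 * base e ^ c <= base e ^ c.+1.
Proof. by rewrite expnS leq_mul2r base_gt2 orbT. Qed.

Lemma base_exp_gt0 e c : 0 < base e ^ c.
Proof. by rewrite expn_gt0 (ltn_trans _ (base_gt2 e)). Qed.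

Lemma base_exp_leq e c c' : c <= c' -> base e ^ c <= base e ^ c'.
Proof. by move=> h; rewrite leq_pexp2l // (ltn_trans _ (base_gt2 e)). Qed.

Lemma base_wid_leq e c c' :
  c <= c' -> base e ^ c * wid e <= base e ^ c' * wid e.
Proof. by move=> h; rewrite leq_mul2r base_exp_leq // orbT. Qed.

Lemma cost_leq e c c' o : c <= c' -> cost e c o -> cost e c' o.
Proof.
move=> h [s q w]; split.
- exact: leq_trans s (base_exp_leq e h).
- exact: leq_trans q (base_exp_leq e h).
- exact: leq_trans w (base_wid_leq e h).
Qed.

Lemma deep_leq e c c' t : c <= c' -> deep e c t -> deep e c' t.
Proof.
move=> h; elim: t => [n|a IHa b IHb] /=.
  by move=> H; apply: leq_trans H (base_wid_leq e h).
by case/andP=> /IHa-> /IHb->.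
Qed.

Lemma exec_leq e c c' p x r : c <= c' -> exec e c p x r -> exec e c' p x r.
Proof.
by move=> h [? ? ?]; split=> //; [apply: cost_leq h _ | apply: deep_leq h _].
Qed.

Lemma exec_eq e c p x r r' : exec e c p x r -> r = r' -> exec e c p x r'.
Proof. by move=> h <-. Qed.

Lemma exec_deep e c p x r : exec e c p x r -> deep e c r.
Proof. by case. Qed.

Lemma deep_bits e c t : deep e c t -> bits t <= base e ^ c * wid e.
Proof. by case: t. Qed.

Lemma deep_fst e c t : deep e c t -> deep e c (tfst t).
Proof.
case: t => [n _|a b /andP[]] //=; rewrite /nbits trunc_log0.
by rewrite muln_gt0 base_exp_gt0 wid_gt0.
Qed.

Lemma deep_snd e c t : deep e c t -> deep e c (tsnd t).
Proof.
case: t => [n _|a b /andP[]] //=; rewrite /nbits trunc_log0.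
by rewrite muln_gt0 base_exp_gt0 wid_gt0.
Qed.

Lemma deep_tnum e c t : deep e c t -> nbits (tnum t) <= base e ^ c * wid e.
Proof.
case: t => [n //|a b _] /=; rewrite /nbits trunc_log0.
by rewrite muln_gt0 base_exp_gt0 wid_gt0.
Qed.

Lemma deep_leaf_leq e c n : n <= base e ^ c -> deep e c.+1 (Leaf n).
Proof.
move=> h /=; apply: leq_trans (nbits_le n) _.
have := base_expS e c; have := base_exp_gt0 e c; have := wid_gt0 e.
by move: (base e ^ c) (base e ^ _) (wid e) h => x y z; nia.
Qed.

Lemma deep_bool e c (b : bool) : deep e c (Leaf b).
Proof.
rewrite /= (_ : nbits b = 1) ?muln_gt0 ?base_exp_gt0 ?wid_gt0 //.
by case: b.
Qed.

Lemma cost_emit0 e c r : deep e c r -> cost e c (emit r [::]).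
Proof. by move=> /deep_bits h; split=> //=; exact: base_exp_gt0. Qed.

Lemma cost_emit1 e c r o : deep e c.+1 r -> cost e c o ->
  cost e c.+1 (emit r [:: o]).
Proof.
move=> /deep_bits h [s q w]; have := base_expS e c; have := base_exp_gt0 e c.
split=> /=; [lia | lia |].
by rewrite geq_max h andbT (leq_trans w) // base_wid_leq.
Qed.

Lemma cost_emit2 e c r o o' : deep e c.+1 r -> cost e c o -> cost e c o' ->
  cost e c.+1 (emit r [:: o; o']).
Proof.
move=> /deep_bits h [s q w] [s' q' w'].
have := base_expS e c; have := base_exp_gt0 e c.
split=> /=; [lia | lia |].
by rewrite !geq_max h andbT (leq_trans w) ?(leq_trans w') // base_wid_leq.
Qed.

Lemma exec_Arg e c x : deep e c x -> exec e c Arg x x.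
Proof. by move=> h; split=> //; exact: cost_emit0. Qed.

(** Crude but uniform in the setting: n < 2^n, and 2 is below the base. Literals belong to a fixed
    program, so the exponent is a constant. *)
Lemma exec_Lit e n x : exec e n.+1 (Lit n) x (Leaf n).
Proof.
have h : deep e n.+1 (Leaf n).
  apply: deep_leaf_leq; apply: leq_trans (ltnW (ltn_expl n (isT : 1 < 2))) _.
  by case: n => // n; rewrite leq_exp2r // ltnW // base_gt2.
by split=> //; exact: cost_emit0.
Qed.

(** Exponents are added rather than maximised: every bound stays a plain expression that unification
    can build and [lia] can compare. *)
Lemma exec_Pair e c c' p q x r r' : exec e c p x r -> exec e c' q x r' ->
  exec e (c + c').+1 (Pair p q) x (Node r r').
Proof.
move=> /(exec_leq (leq_addr c' c))[<- h1 h2].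
move=> /(exec_leq (leq_addl c c'))[<- h3 h4].
have d : deep e (c + c').+1 (Node (res (run (orc e) p x)) (res (run (orc e) q x))).
  by rewrite /= !(deep_leq (leqnSn _)).
by split=> //; exact: cost_emit2.
Qed.

Lemma exec_Fst e c p x r : exec e c p x r -> exec e c.+1 (Fst p) x (tfst r).
Proof.
move=> [<- h1 h2]; have d := deep_leq (leqnSn _) (deep_fst h2).
by split=> //; exact: cost_emit1.
Qed.

Lemma exec_Snd e c p x r : exec e c p x r -> exec e c.+1 (Snd p) x (tsnd r).
Proof.
move=> [<- h1 h2]; have d := deep_leq (leqnSn _) (deep_snd h2).
by split=> //; exact: cost_emit1.
Qed.

Lemma exec_Op e o c c' p q x r r' : exec e c p x r -> exec e c' q x r' ->
  exec e (c + c').+1 (Op o p q) x (Leaf (arith_op o (tnum r) (tnum r'))).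
Proof.
move=> /(exec_leq (leq_addr c' c))[<- h1 /deep_tnum h2].
move=> /(exec_leq (leq_addl c c'))[<- h3 /deep_tnum h4].
have d : deep e (c + c').+1 (Leaf (arith_op o (tnum (res (run (orc e) p x)))
   (tnum (res (run (orc e) q x))))).
  apply: leq_trans (nbits_arith _ _ _) _.
  have := base_expS e (c + c'); have := base_exp_gt0 e (c + c').
  have := wid_gt0 e; move: h2 h4.
  by move: (base e ^ _) (base e ^ _) (wid e) => a b w; nia.
by split=> //; exact: cost_emit2.
Qed.

Lemma exec_Cond e c1 c2 c3 p q q' x r r1 r2 : exec e c1 p x r ->
  (tnum r != 0 -> exec e c2 q x r1) -> (tnum r = 0 -> exec e c3 q' x r2) ->
  exec e (c1 + c2 + c3).+1 (Cond p q q') x (if tnum r != 0 then r1 else r2).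
Proof.
move=> /(@exec_leq _ _ (c1 + c2 + c3))[]; first by lia.
move=> <- h1 h2 Hq Hq'; rewrite /exec /=.
case: ifPn => [/Hq|/negbNE/eqP/Hq'] /(@exec_leq _ _ (c1 + c2 + c3))[];
  try lia; move=> <- h3 h4;
  by split=> //; [apply: cost_emit2 => // |]; apply: deep_leq h4.
Qed.

Lemma exec_Comp e c c' f p x r r' : exec e c p x r -> exec e c' f r r' ->
  exec e (c + c').+1 (Comp f p) x r'.
Proof.
move=> /(exec_leq (leq_addr c' c))[<- h1 h2].
move=> /(exec_leq (leq_addl c c'))[<- h3 h4].
by split=> //=; [apply: cost_emit2 => // |]; apply: deep_leq h4.
Qed.

Lemma exec_Query e i c p x r : exec e c p x r ->
  exec e c.+1 (Query i p) x (Leaf (orc e i r)).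
Proof.
move=> [<- h1 h2].
have d : deep e c.+1 (Leaf (orc e i (res (run (orc e) p x)))).
  by apply: leq_trans (orc_wid e i _) _; rewrite leq_pmull // base_exp_gt0.
split=> //=; case: (cost_emit1 d h1) => s q w; split=> //=.
move: h1 => [_ q1 _]; have := base_expS e c; have := base_exp_gt0 e c; lia.
Qed.

(** All rounds are bounded with the same exponent [c3], so the number of rounds enters the cost only
    as a factor. The width is a maximum and is not multiplied at all. *)
Lemma exec_Iter e c1 c2 c3 c4 p q f x n (st : nat -> tree) :
  exec e c1 p x (Leaf n) -> exec e c2 q x (st 0) ->
  (forall j, j < n -> exec e c3 f (st j) (st j.+1)) -> n <= base e ^ c4 ->
  exec e (2 * (c1 + c2 + c3 + c4)).+2 (Iter p q f) x (st n).
Proof.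
set c := c1 + c2 + c3 + c4.
move=> /(@exec_leq _ _ c)[]; first by lia.
move=> h1 h2 h3 /(@exec_leq _ _ c)[]; first by lia.
move=> h4 h5 h6 hf hn.
have {}hn : n <= base e ^ c by apply: leq_trans hn (base_exp_leq _ _); lia.
rewrite /exec /= h1 /=.
set rnd := fun o : outcome => _.
have key j : j <= n -> let o := iter j rnd (run (orc e) q x) in
    [/\ res o = st j, steps o <= base e ^ c + j * (base e ^ c).+1,
        queries o <= base e ^ c + j * (base e ^ c).+1,
        width o <= base e ^ c * wid e & deep e c (st j)].
  elim: j => [_|j IH jn] /=; first by case: h5 => *; split=> //; lia.
  have [r1 s1 q1 w1 d1] := IH (ltnW jn).
  have /(@exec_leq _ _ c)[] := hf j jn; first by lia.
  move=> r2 [s2 q2 w2] d2; rewrite r1; split=> //=.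
  - rewrite addn0 mulSn; move: s1 s2; lia.
  - rewrite addn0 mulSn; move: q1 q2; lia.
  - rewrite !geq_max w1 w2 /=; apply: deep_bits; by rewrite r2.
have [r1 s1 q1 w1 d1] := key n (leqnn n).
(* With y for the power and n <= y, the left side is at most y + y (y + 1) <= 3 y^2. *)
have H : base e ^ c + n * (base e ^ c).+1 <= base e ^ (2 * c).+1.
  apply: leq_trans (base_expS e _); rewrite mul2n -addnn expnD.
  have := base_exp_gt0 e c; move: (base e ^ c) hn => y; nia.
have C2 : cost e (2 * c).+1 (iter n rnd (run (orc e) q x)).
  split; [exact: leq_trans s1 H | exact: leq_trans q1 H |].
  by apply: leq_trans w1 (base_wid_leq _ _); lia.
have D : deep e (2 * c).+2 (st n) by apply: deep_leq d1; lia.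
split=> //; apply: cost_emit2 => //; first by rewrite r1.
by apply: cost_leq h2; lia.
Qed.

(** * Loops *)

(** The rules are directed by the syntax of the program; the exponent is an existential variable
    that they fill in. *)
Ltac exec_step :=
  lazymatch goal with
  | |- exec _ _ Arg _ _ => eapply exec_Arg
  | |- exec _ _ (Lit _) _ _ => eapply exec_Lit
  | |- exec _ _ (Pair _ _) _ _ => eapply exec_Pair
  | |- exec _ _ (Fst _) _ _ => eapply exec_Fst
  | |- exec _ _ (Snd _) _ _ => eapply exec_Snd
  | |- exec _ _ (Op _ _ _) _ _ => eapply exec_Op
  | |- exec _ _ (Query _ _) _ _ => eapply exec_Query
  | |- is_true (deep _ _ _) => eassumption
  end.

Ltac exec_auto := repeat exec_step.
Ltac exec_run := eapply exec_eq; [exec_auto | try reflexivity].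

Lemma deep_Node e c c' a b : deep e c a -> deep e c' b -> deep e (c + c') (Node a b).
Proof.
by move=> /(deep_leq (leq_addr c' c)) /= -> /(deep_leq (leq_addl c c')) ->.
Qed.

(* The state of the loop is the round number, a constant and an accumulator. *)
Definition Fold (pn pe pi f : prog) : prog :=
  Snd (Snd (Iter pn (Pair (Lit 0) (Pair pe pi))
    (Pair (Op Add (Fst Arg) (Lit 1)) (Pair (Fst (Snd Arg)) f)))).

Lemma exec_Fold e c1 c2 c3 c4 c5 c6 pn pe pi f x n env (g : nat -> tree) :
  exec e c1 pn x (Leaf n) -> exec e c2 pe x env -> exec e c3 pi x (g 0) ->
  n <= base e ^ c4 -> (forall j, j < n -> deep e c5 (g j)) ->
  (forall j, j < n ->
     deep e (c4.+1 + (c2 + c5)) (Node (Leaf j) (Node env (g j))) ->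
     exec e c6 f (Node (Leaf j) (Node env (g j))) (g j.+1)) ->
  exec e (30 * (c1 + c2 + c3 + c4 + c5 + c6) + 50) (Fold pn pe pi f) x (g n).
Proof.
move=> h1 h2 h3 h4 h5 h6.
pose st j := Node (Leaf j) (Node env (g j)).
(* The rules first determine some exponent, which is compared with the stated one at the very
   end. *)
apply: exec_leq; last first.
  eapply exec_eq.
    eapply exec_Snd, exec_Snd, (exec_Iter (st := st)); [exact: h1| | |exact: h4].
    - exec_auto; [exact: h2 | exact: h3].
    - move=> j jn.
      have D : deep e (c4.+1 + (c2 + c5)) (st j).
        apply: deep_Node; last exact: deep_Node (exec_deep h2) (h5 j jn).
        by apply: deep_leaf_leq; rewrite (leq_trans (ltnW jn)).
      eapply exec_eq.
        exec_auto; exact: h6 j jn D.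
      by rewrite /st /= addn1.
  by [].
lia.
Qed.

(** Entries are added in front, so round j computes the entry of index n - 1 - j; the length n
    travels with the environment for this subtraction. *)
Definition Tab (pn pe f : prog) : prog :=
  Fold pn (Pair pn pe) (Lit 0)
    (Pair (Comp f (Pair (Op Defs.Sub (Op Defs.Sub (Fst (Fst (Snd Arg))) (Lit 1)) (Fst Arg))
                        (Snd (Fst (Snd Arg)))))
          (Snd (Snd Arg))).

Lemma deep_enc_seq (T : eqType) e c (h : T -> tree) s :
  (forall l, l \in s -> deep e c (h l)) -> deep e c (enc_seq (map h s)).
Proof.
rewrite /enc_seq; elim: s => [_|l s IH H]; first exact: (deep_bool e c false).
rewrite /= H ?inE ?eqxx // IH // => l' l's; apply: H; rewrite inE l's orbT //.
Qed.

Lemma exec_Tab e c1 c2 c3 c4 pn pe f x n env (h : nat -> tree) :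
  exec e c1 pn x (Leaf n) -> exec e c2 pe x env -> n <= base e ^ c3 ->
  (forall l, l < n -> deep e (c1 + c3.+1 + c2) (Node (Leaf l) env) ->
     exec e c4 f (Node (Leaf l) env) (h l)) ->
  exec e (300 * (c1 + c2 + c3 + c4) + 1000) (Tab pn pe f) x
    (enc_seq [seq h l | l <- iota 0 n]).
Proof.
move=> h1 h2 h3 h4.
have D l : l < n -> deep e (c1 + c3.+1 + c2) (Node (Leaf l) env).
  move=> ln; apply: deep_Node (exec_deep h2).
  by apply: deep_leq (leq_addl _ _) _; apply: deep_leaf_leq; apply: leq_trans (ltnW ln) h3.
pose g j := enc_seq [seq h l | l <- iota (n - j) j].
apply: exec_leq; last first.
  eapply exec_eq.
    eapply (exec_Fold (g := g)); [exact: h1 | | | exact: h3 | |].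
    - exec_auto; [exact: h1 | exact: h2].
    - exec_auto.
    - move=> j jn; apply: (@deep_leq _ c4) => //.
      apply: deep_enc_seq => l; rewrite mem_iota => /andP[_ lt].
      have ln : l < n by move: lt; rewrite subnK // ltnW.
      exact: exec_deep (h4 l ln (D l ln)).
    - move=> j jn DD.
      eapply exec_eq.
        exec_auto; eapply exec_Comp; first by exec_auto.
        have ln : n - 1 - j < n by lia.
        exact: h4 (D _ ln).
      rewrite /= /g (_ : n - j = (n - j.+1).+1) /=; last lia.
      by rewrite (_ : n - 1 - j = n - j.+1); last lia.
  by rewrite /g subnn.
lia.
Qed.

Definition Nth (pl ps : prog) : prog := Fst (Iter pl ps (Snd Arg)).

Lemma deep_iter_snd e c t l : deep e c t -> deep e c (iter l tsnd t).
Proof. by move=> h; elim: l => //= l; exact: deep_snd. Qed.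

Lemma exec_Nth e c1 c2 c3 pl ps x l t :
  exec e c1 pl x (Leaf l) -> exec e c2 ps x t -> l <= base e ^ c3 ->
  exec e (10 * (c1 + c2 + c3) + 10) (Nth pl ps) x (tfst (iter l tsnd t)).
Proof.
move=> h1 h2 h3; apply: exec_leq; last first.
  eapply exec_Fst, (exec_Iter (st := fun j => iter j tsnd t)).
  - exact: h1.
  - exact: h2.
  - move=> j _; have D := deep_iter_snd j (exec_deep h2); exec_auto.
  - exact: h3.
lia.
Qed.

Lemma tfst_iter_enc_seq s j : tfst (iter j tsnd (enc_seq s)) = nth (Leaf 0) s j.
Proof.
elim: j s => [|j IH] [|y s] //=; last by rewrite -iterS iterSr IH.
by rewrite -iterS iterSr /= -[Leaf 0]/(enc_seq [::]) IH nth_nil.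
Qed.

Lemma map_enum_ord (T : Type) n (h : nat -> T) :
  [seq h (l : 'I_n) | l <- enum 'I_n] = [seq h l | l <- iota 0 n].
Proof. by rewrite -val_enum_ord -map_comp. Qed.

Lemma enc_set_iota n (S : {set 'I_n}) (h : nat -> tree) :
  (forall i : 'I_n, h i = Leaf (i \in S)) ->
  enc_seq [seq h l | l <- iota 0 n] = enc_set S.
Proof.
by move=> H; rewrite -map_enum_ord /enc_set; congr enc_seq; apply: eq_map => i.
Qed.

Lemma tfst_iter_enc_set n (S : {set 'I_n}) (i : 'I_n) :
  tfst (iter i tsnd (enc_set S)) = Leaf (i \in S).
Proof.
by rewrite tfst_iter_enc_seq (nth_map i) ?size_enum_ord // nth_ord_enum.
Qed.

(** Leaves of an encoded set are 0 or 1, so exponent 0 suffices: loops that accumulate a set keep a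
    constant depth. *)
Lemma deep_enc_set e c n (S : {set 'I_n}) : deep e c (enc_set S).
Proof. by apply: deep_enc_seq => i _; exact: deep_bool. Qed.

(** * The programs of the reduction *)

(** The base dominates the round numbers of the loops, and [wid] the bit length of the values. Both
    cost models provide such a setting, with base km + 1 or kms + 1. *)
Definition fits e k m (v w : valn m) : Prop :=
  [/\ orc e = oracles v w, k <= base e, m <= base e, k.-1 * m <= base e
    & nbits (vmax v w) <= wid e].

Lemma oracles0 m (v w : valn m) S : oracles v w 0 (enc_set S) = v S.
Proof. by rewrite /oracles enc_setK. Qed.

Lemma oracles1 m (v w : valn m) S : oracles v w 1 (enc_set S) = w S.
Proof. by rewrite /oracles enc_setK. Qed.

Definition pvmax : prog :=
  Comp (Cond (Op Leq (Fst Arg) (Snd Arg)) (Snd Arg) (Fst Arg))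
    (Comp (Pair (Query 0 Arg) (Query 1 Arg)) (Tab (Fst (Snd Arg)) (Lit 0) (Lit 1))).

Lemma leq_base1 e n : n <= base e -> n <= base e ^ 1.
Proof. by rewrite expn1. Qed.

(** The exponent is fixed before the setting, the sizes and the valuations: this uniformity is what
    polynomial time means here. [eexists] leaves it to be inferred from the program. *)
Lemma exec_pvmax c : exists c', forall e k m (v w : valn m) rest,
  fits e k v w -> deep e c (Node (Leaf k) (Node (Leaf m) rest)) ->
  exec e c' pvmax (Node (Leaf k) (Node (Leaf m) rest)) (Leaf (vmax v w)).
Proof.
eexists => e k m v w rest [ho hk hm hkm hV] D.
eapply exec_eq.
  eapply exec_Comp.
    eapply exec_Comp.
      eapply (exec_Tab (h := fun=> Leaf 1)); [exec_run | exec_auto | exact: (leq_base1 hm) |].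
      by move=> l _ _; exec_auto.
    rewrite (@enc_set_iota _ [set: 'I_m]); last by move=> i; rewrite inE.
    have D1 : deep e 0 (enc_set [set: 'I_m]) by exact: deep_enc_set.
    by exec_auto.
  rewrite ho oracles0 oracles1.
  have D2 : deep e 0 (Node (Leaf (v [set: 'I_m])) (Leaf (w [set: 'I_m]))).
    rewrite /= expn0 mul1n; apply/andP; split; apply: leq_trans hV;
    by apply: nbits_leq; rewrite ?leq_maxl ?leq_maxr.
  eapply exec_Cond; first (by exec_auto); by move=> _; exec_auto.
by rewrite /vmax /=; case: leqP.
Qed.

(** The factors C_l. The first ratio is 2 V and all later ones are 2 k V; [scale_mul_le] shows what
    the smaller first step buys. *)
Definition scale k V l : nat := if l is l'.+1 then 2 * V * (2 * k * V) ^ l' else 1.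

(** The bit length of a power is about the exponent times that of its base, here j (3 + base + wid)
    bits with j <= k <= base. *)
Lemma nbits_scale e k V j : k <= base e -> nbits V <= wid e -> j <= k ->
  nbits (2 * V * (2 * k * V) ^ j) <= base e ^ 4 * wid e.
Proof.
move=> hk hV hj.
apply: leq_trans (nbits_mul _ _) _.
apply: leq_trans (leq_add (nbits_mul _ _) (nbits_exp _ _)) _.
have h2 : nbits 2 = 2 by [].
have hB : nbits (2 * k * V) <= 3 + base e + wid e.
  apply: leq_trans (nbits_mul _ _) _.
  apply: leq_add => //; apply: leq_trans (nbits_mul _ _) _.
  by rewrite h2; have := nbits_le k; move: (nbits k) => x; lia.
have hjB : j * nbits (2 * k * V) <= base e * (3 + base e + wid e).
  by apply: leq_mul => //; apply: leq_trans hj hk.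
rewrite h2; clear hB; move: (j * _) (nbits V) hjB hV => a b.
move: (base e) (wid e) (base_gt2 e) (wid_gt0 e) => N W hN hW ha hb.
have -> : N ^ 4 * W = N * N * (N * (N * W)) by rewrite !expnS expn0 muln1 !mulnA.
have h1 : 3 <= N * W by nia.
have h3 : N <= N * W by nia.
have h4 : W <= N * W by nia.
have h5 : N * (3 + N + W) <= N * (3 * (N * W)) by rewrite leq_mul2l; lia.
have h6 : N * (3 * (N * W)) <= N * (N * (N * W)) by rewrite leq_mul2l leq_mul2r; lia.
move: (N * W) h1 h3 h4 h5 h6 => x h1 h3 h4 h5 h6.
have h7 : 2 * x <= N * (N * x).
  by apply: leq_trans (_ : N * x <= _); [rewrite leq_mul2r ltnW ?orbT | rewrite leq_mul2l leq_pmull ?orbT // ltnW // ltnW].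
have h8 : N * (N * x) + N * (N * x) <= N * N * (N * x).
  by rewrite -mulnA; move: (N * (N * x)) => y; nia.
lia.
Qed.

Lemma deep_scale e k V l : k <= base e -> nbits V <= wid e -> l <= k ->
  deep e 4 (Leaf (scale k V l)).
Proof.
case: l => [|l] hk hV hl; first exact: (deep_bool e 4 true).
by apply: nbits_scale => //; exact: ltnW.
Qed.

Definition pscale : prog :=
  Cond (Fst Arg)
    (Fold (Op Defs.Sub (Fst Arg) (Lit 1))
       (Op Mul (Lit 2) (Op Mul (Fst (Snd Arg)) (Snd (Snd Arg))))
       (Op Mul (Lit 2) (Snd (Snd Arg)))
       (Op Mul (Snd (Snd Arg)) (Fst (Snd Arg))))
    (Lit 1).

Lemma deep_nkV e k V l : k <= base e -> nbits V <= wid e -> l <= k ->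
  deep e 4 (Node (Leaf l) (Node (Leaf k) (Leaf V))).
Proof.
move=> hk hV hl.
have h n : n <= base e -> deep e 4 (Leaf n).
  by move=> hn; apply: (@deep_leq _ 2) => //; apply: deep_leaf_leq; exact: leq_base1.
apply/andP; split; first exact: h (leq_trans hl hk).
apply/andP; split; first exact: h hk.
rewrite /=.
by apply: leq_trans hV _; rewrite leq_pmull // base_exp_gt0.
Qed.

Lemma exec_pscale : exists c, forall e k V l,
  k <= base e -> nbits V <= wid e -> l <= k ->
  exec e c pscale (Node (Leaf l) (Node (Leaf k) (Leaf V))) (Leaf (scale k V l)).
Proof.
eexists => e k V l hk hV hl; have D := deep_nkV hk hV hl.
eapply exec_eq.
  eapply exec_Cond; [exec_auto | move=> hl0 | by move=> _; exec_auto].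
  eapply (exec_Fold (n := l - 1) (env := Leaf (2 * (k * V)))
           (g := fun j => Leaf (2 * V * (2 * k * V) ^ j))).
  - by exec_run.
  - by exec_run.
  - exec_run; by rewrite /= expn0 muln1.
  - by apply: leq_base1; apply: leq_trans hk; lia.
  - move=> j jl; apply: nbits_scale => //; lia.
  - move=> j jl DD; exec_run; by rewrite /= expnSr (mulnA 2 k) -(mulnA (2 * V)).
case: l hl D => [|l] //= *; by rewrite subn1.
Qed.

Definition pratio : prog :=
  Cond (Op Leq (Op Add (Lit 2) (Fst Arg)) (Fst (Snd Arg)))
    (Comp (Pair (Op Defs.Sub (Snd Arg) (Fst Arg)) (Op Mul (Fst Arg) (Snd Arg)))
       (Pair pscale (Comp pscale (Pair (Op Add (Lit 1) (Fst Arg)) (Snd Arg)))))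
    (Pair (Lit 1) pscale).

(** The probability of type l is 1 / C_l - 1 / C_(l+1), and 1 / C_(k-1) for the last type, brought
    to a single fraction. *)
Definition ratio_num k V l :=
  if l.+2 <= k then scale k V l.+1 - scale k V l else 1.
Definition ratio_den k V l :=
  if l.+2 <= k then scale k V l * scale k V l.+1 else scale k V l.

Lemma exec_pratio : exists c, forall e k V l,
  k <= base e -> nbits V <= wid e -> l < k ->
  exec e c pratio (Node (Leaf l) (Node (Leaf k) (Leaf V)))
    (Node (Leaf (ratio_num k V l)) (Leaf (ratio_den k V l))).
Proof.
have [c Hc] := exec_pscale.
eexists => e k V l hk hV hl; have D := deep_nkV hk hV (ltnW hl).
eapply exec_eq.
  eapply exec_Cond; [exec_auto | move=> hl0 | move=> hl0].
  - eapply exec_Comp.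
      eapply exec_Pair; first exact: Hc hk hV (ltnW hl).
      eapply exec_Comp; first by exec_auto.
      exact: (Hc e k V l.+1 hk hV hl).
    have D2 := deep_Node (deep_scale hk hV (ltnW hl)) (deep_scale hk hV hl).
    by exec_auto.
  - eapply exec_Pair; [by exec_auto | exact: Hc hk hV (ltnW hl)].
by rewrite /ratio_num /ratio_den /=; case: leqP.
Qed.

Definition pratios : prog := Tab (Fst Arg) (Pair (Fst Arg) pvmax) pratio.

Lemma exec_pratios c : exists c', forall e k m (v w : valn m) rest,
  fits e k v w -> deep e c (Node (Leaf k) (Node (Leaf m) rest)) ->
  exec e c' pratios (Node (Leaf k) (Node (Leaf m) rest))
    (enc_ratios (fun l : 'I_k => ratio_num k (vmax v w) l)
                (fun l : 'I_k => ratio_den k (vmax v w) l)).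
Proof.
have [c1 H1] := exec_pvmax c; have [c2 H2] := exec_pratio.
eexists => e k m v w rest hf D; have [ho hk hm hkm hV] := hf.
eapply exec_eq.
  eapply (exec_Tab (n := k) (env := Node (Leaf k) (Leaf (vmax v w)))
    (h := fun l => Node (Leaf (ratio_num k (vmax v w) l)) (Leaf (ratio_den k (vmax v w) l)))).
  - by exec_run.
  - exec_run; exact: H1 hf D.
  - exact: leq_base1.
  - by move=> l lk _; exact: H2.
by rewrite -map_enum_ord.
Qed.

(** * Greedy deletion, candidate sets and their programs *)

Fixpoint shrink n (f : {set 'I_n} -> nat) (S : {set 'I_n}) (j : nat) : {set 'I_n} :=
  if j is j'.+1 then
    let S' := shrink f S j' in
    let T := S' :\: [set i : 'I_n | i == j' :> nat] in
    if f S' <= f T then T else S'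
  else S.

(** Convertible to [copy_of] when n is [k.-1 * m]; the index is a plain number, to suit loop
    counters. *)
Definition copy_at n m (S : {set 'I_n}) (i : nat) : {set 'I_m} :=
  [set j : 'I_m | [exists x in S, x == i * m + j :> nat]].

(** With [K.+1] for k, the dimension [k.-1 * m] computes to [K * m]. [inord] is exact on the indices
    l < K that occur. *)
Definition candidate K m (v w : valn m)
    (omega : {ffun 'I_K.+1 -> {set 'I_(K * m)}}) (l : nat) : {set 'I_m} :=
  copy_at m (shrink (@IT K.+1 m v w (inord l)) (omega (inord l)) (K * m)) l.

(** Differences v - w are compared through sums, because subtraction of naturals truncates. Starting
    from the empty set keeps the difference of the result non-negative. *)
Fixpoint best m (v w : valn m) (c : nat -> {set 'I_m}) (j : nat) : {set 'I_m} :=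
  if j is j'.+1 then
    let b := best v w c j' in
    if v (c j') + w b <= v b + w (c j') then b else c j'
  else finset.set0.

Definition simulates e k m (v w : valn m) (psim : prog) c : Prop :=
  forall (l : 'I_k) (S : {set 'I_(k.-1 * m)}),
    exec e c psim (enc_seq [:: Leaf k; Leaf m; Leaf l; enc_set S])
      (Leaf (IT v w l S)).

Section Programs.
Variable psim : prog.

(** With truncated subtraction, (i - j) + (j - i) is nonzero exactly when i and j differ. *)
Definition pdelete : prog :=
  Tab (Op Mul (Op Defs.Sub (Fst (Fst (Snd Arg))) (Lit 1)) (Fst (Snd (Fst (Snd Arg))))) Arg
    (Cond (Op Add (Op Defs.Sub (Fst Arg) (Fst (Snd Arg)))
                  (Op Defs.Sub (Fst (Snd Arg)) (Fst Arg)))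
       (Nth (Fst Arg) (Snd (Snd (Snd Arg)))) (Lit 0)).

Lemma exec_pdelete c : exists c', forall e k m l (S : {set 'I_(k.-1 * m)}) j,
  k.-1 * m <= base e -> j < k.-1 * m ->
  deep e c (Node (Leaf j) (Node (Node (Leaf k) (Node (Leaf m) (Leaf l))) (enc_set S))) ->
  exec e c' pdelete
    (Node (Leaf j) (Node (Node (Leaf k) (Node (Leaf m) (Leaf l))) (enc_set S)))
    (enc_set (S :\: [set i : 'I_(k.-1 * m) | i == j :> nat])).
Proof.
eexists => e k m l S j hkm jk D.
eapply exec_eq.
  eapply (exec_Tab (n := k.-1 * m)
    (h := fun i => if (i - j) + (j - i) != 0 then tfst (iter i tsnd (enc_set S)) else Leaf 0)).
  - by exec_run; rewrite /= subn1.
  - by exec_auto.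
  - exact: leq_base1.
  - move=> i ij DD; eapply exec_eq.
      eapply exec_Cond; [by exec_auto | move=> _ | by move=> _; exec_auto].
      eapply (exec_Nth (l := i)); [by exec_run | by exec_auto |].
      by apply: leq_base1; apply: leq_trans (ltnW ij) hkm.
    by [].
apply: enc_set_iota => i; rewrite tfst_iter_enc_set !inE.
case: (eqVneq (i : nat) j) => [->|ne]; first by rewrite !subnn.
by have -> : (i - j + (j - i) != 0) = true by lia.
Qed.

Definition psim_on (a : prog) : prog :=
  Comp psim (Pair (Fst (Fst (Snd (Snd Arg)))) (Pair (Fst (Snd (Fst (Snd (Snd Arg)))))
    (Pair (Snd (Snd (Fst (Snd (Snd Arg))))) (Pair a (Lit 0))))).

Definition pminimize : prog :=
  Fold (Op Mul (Op Defs.Sub (Fst Arg) (Lit 1)) (Fst (Snd Arg)))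
    (Pair (Fst Arg) (Pair (Fst (Snd Arg)) (Fst (Snd (Snd Arg)))))
    (Fst (Snd (Snd (Snd Arg))))
    (Comp (Cond (Op Leq (psim_on (Snd (Snd (Snd Arg)))) (psim_on (Fst Arg)))
             (Fst Arg) (Snd (Snd (Snd Arg))))
       (Pair pdelete Arg)).

Lemma exec_pminimize c c1 : exists c', forall e k m (v w : valn m) (l : 'I_k)
    (S : {set 'I_(k.-1 * m)}),
  fits e k v w -> simulates e k v w psim c ->
  deep e c1 (enc_seq [:: Leaf k; Leaf m; Leaf l; enc_set S]) ->
  exec e c' pminimize (enc_seq [:: Leaf k; Leaf m; Leaf l; enc_set S])
    (enc_set (shrink (@IT k m v w l) S (k.-1 * m))).
Proof.
have [c2 H2] := exec_pdelete (4 + (c1.+4 + 0)).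
eexists => e k m v w l S [ho hk hm hkm hV] Hs D.
pose f := @IT k m v w l.
eapply (exec_Fold (n := k.-1 * m) (env := Node (Leaf k) (Node (Leaf m) (Leaf l)))
  (g := fun j => enc_set (shrink f S j))).
- by exec_run; rewrite /= subn1.
- by exec_run.
- by exec_run.
- exact: leq_base1.
- by move=> j _; exact: (deep_enc_set e 0).
- move=> j jn DD.
  have D1 : deep e 4 (Leaf j).
    apply: (@deep_leq _ 2) => //; apply: deep_leaf_leq; apply: leq_base1.
    exact: leq_trans (ltnW jn) hkm.
  have D2 : deep e c1.+4 (Node (Leaf k) (Node (Leaf m) (Leaf l))).
    apply: (@deep_leq _ c1); first by rewrite -addn4 leq_addr.
    by move: D => /= /and5P[-> -> -> _ _].
  (* The depth of the state is established at the very exponent for which [exec_pdelete] was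
     instantiated. *)
  have D3 := deep_Node D1 (deep_Node D2 (deep_enc_set e 0 (shrink f S j))).
  eapply exec_eq.
    eapply exec_Comp.
      eapply exec_Pair; [exact: H2 hkm jn D3 | by exec_auto].
    have D4 := deep_Node (deep_enc_set e 0 (shrink f S j :\: [set i : 'I_(k.-1 * m) | i == j :> nat])) D3.
    eapply exec_Cond; [| by move=> _; exec_auto | by move=> _; exec_auto].
    eapply exec_Op; (eapply exec_Comp; [by exec_auto|]); exact: Hs.
  by rewrite /=; case: leqP.
Qed.

Definition pcandidate : prog :=
  Comp (Tab (Fst (Snd Arg)) Arg
          (Nth (Op Add (Fst (Snd Arg)) (Fst Arg)) (Snd (Snd (Snd Arg)))))
    (Pair (Op Mul (Fst Arg) (Snd (Fst (Fst (Snd Arg)))))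
       (Pair (Snd (Fst (Fst (Snd Arg))))
          (Comp pminimize (Pair (Fst (Fst (Fst (Snd Arg)))) (Pair (Snd (Fst (Fst (Snd Arg))))
             (Pair (Fst Arg) (Pair (Nth (Fst Arg) (Snd (Fst (Snd Arg)))) (Lit 0)))))))).

Definition pfinish : prog :=
  Fold (Op Defs.Sub (Fst (Fst Arg)) (Lit 1))
    (Pair (Pair (Fst (Fst Arg)) (Fst (Snd (Fst Arg)))) (Fst (Snd (Snd Arg))))
    (Tab (Fst (Snd (Fst Arg))) (Lit 0) (Lit 0))
    (Comp (Cond (Op Leq (Op Add (Query 0 (Fst Arg)) (Query 1 (Snd Arg)))
                        (Op Add (Query 0 (Snd Arg)) (Query 1 (Fst Arg))))
             (Snd Arg) (Fst Arg))
       (Pair pcandidate (Snd (Snd Arg)))).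

Lemma nth_enc_draws n K (omega : {ffun 'I_K.+1 -> {set 'I_n}}) l : l < K.+1 ->
  tfst (iter l tsnd (enc_draws omega)) = enc_set (omega (inord l)).
Proof.
move=> lK; rewrite tfst_iter_enc_seq (nth_map (inord l)) ?size_enum_ord //.
congr (enc_set (omega _)); apply: val_inj.
by rewrite /= nth_enum_ord // inordK.
Qed.

Lemma deep_enc_draws e c n k (omega : {ffun 'I_k -> {set 'I_n}}) :
  deep e c (enc_draws omega).
Proof. by apply: deep_enc_seq => i _; exact: deep_enc_set. Qed.

Lemma exec_pcandidate c c1 : exists c', forall e K m (v w : valn m)
    (omega : {ffun 'I_K.+1 -> {set 'I_(K * m)}}) l t,
  fits e K.+1 v w -> simulates e K.+1 v w psim c -> l < K ->
  deep e c1 (Node (Leaf l) (Node (Node (Node (Leaf K.+1) (Leaf m)) (enc_draws omega)) t)) ->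
  exec e c' pcandidate
    (Node (Leaf l) (Node (Node (Node (Leaf K.+1) (Leaf m)) (enc_draws omega)) t))
    (enc_set (candidate v w omega l)).
Proof.
have [c2 H2] := exec_pminimize c c1.
eexists => e K m v w omega l t hf Hs lK D; have [ho hk hm hkm hV] := hf.
have lK' : l < K.+1 by exact: ltnW.
have [Dk Dm Dl] : [/\ deep e c1 (Leaf K.+1), deep e c1 (Leaf m) & deep e c1 (Leaf l)].
  by move: D => /= /and3P[-> /andP[/andP[-> ->] _] _].
pose S := shrink (@IT K.+1 m v w (inord l)) (omega (inord l)) (K * m).
have := H2 e K.+1 m v w (inord l) (omega (inord l)) hf Hs; rewrite inordK // => H3.
eapply exec_eq.
  eapply exec_Comp.
    eapply exec_Pair; first by exec_auto.
    eapply exec_Pair; first by exec_auto.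
    eapply exec_Comp.
      eapply exec_Pair; first by exec_auto.
      eapply exec_Pair; first by exec_auto.
      eapply exec_Pair; first by exec_auto.
      eapply exec_Pair; last by exec_auto.
      eapply (exec_Nth (l := l)); [by exec_run | by exec_run |].
      by apply: leq_base1; apply: leq_trans (ltnW lK') hk.
    rewrite nth_enc_draws //; apply: H3.
    apply/and5P; split=> //; first exact: deep_enc_set.
    exact: (deep_bool e c1 false).
  have Dl' : deep e 4 (Leaf (l * m)).
    apply: (@deep_leq _ 2) => //; apply: deep_leaf_leq; apply: leq_base1.
    by apply: leq_trans hkm; rewrite leq_mul2r (ltnW lK) orbT.
  have D2 := deep_Node Dl' (deep_Node Dm (deep_enc_set e 0 S)).
  eapply (exec_Tab (n := m) (env := Node (Leaf (l * m)) (Node (Leaf m) (enc_set S)))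
    (h := fun j => tfst (iter (l * m + j) tsnd (enc_set S)))).
  - by exec_run.
  - by exec_auto.
  - exact: leq_base1.
  - move=> j jm DD; eapply (exec_Nth (l := l * m + j)); [by exec_run | by exec_run |].
    apply: leq_base1; apply: leq_trans hkm; rewrite /= -(addn1 l) in lK *.
    have : (l + 1) * m <= K * m by rewrite leq_mul2r lK orbT.
    by rewrite mulnDl mul1n; lia.
apply: enc_set_iota => j.
have jlt : l * m + j < K * m.
  have : l.+1 * m <= K * m by rewrite leq_mul2r lK orbT.
  by rewrite mulSn; have := ltn_ord j; lia.
rewrite (tfst_iter_enc_set S (Ordinal jlt)); congr (Leaf (nat_of_bool _)).
rewrite /candidate -/S inE; apply/idP/existsP => [jS|[x /andP[xS /eqP xe]]].
  by exists (Ordinal jlt); rewrite jS /=.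
by rewrite (_ : Ordinal jlt = x) //; apply: val_inj.
Qed.

Lemma exec_pfinish c c1 : exists c', forall e K m (v w : valn m) rest y
    (omega : {ffun 'I_K.+1 -> {set 'I_(K * m)}}),
  fits e K.+1 v w -> simulates e K.+1 v w psim c ->
  deep e c1 (Node (Leaf K.+1) (Node (Leaf m) rest)) -> deep e c1 y ->
  exec e c' pfinish
    (enc_seq [:: Node (Leaf K.+1) (Node (Leaf m) rest); y; enc_draws omega])
    (enc_set (best v w (candidate v w omega) K)).
Proof.
have [c2 H2] := exec_pcandidate c (2 + (c1 + c1 + 0 + 0)).
eexists => e K m v w rest y omega hf Hs Dx Dy; have [ho hk hm hkm hV] := hf.
have D := deep_Node Dx (deep_Node Dy (deep_Node (deep_enc_draws e 0 omega) (deep_bool e 0 false))).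
have [Dk Dm] : deep e c1 (Leaf K.+1) /\ deep e c1 (Leaf m).
  by move: Dx => /= /and3P[-> -> _].
eapply (exec_Fold (n := K) (env := Node (Node (Leaf K.+1) (Leaf m)) (enc_draws omega))
  (g := fun j => enc_set (best v w (candidate v w omega) j))).
- by exec_run; rewrite /= subn1.
- by exec_run.
- eapply exec_eq.
    eapply (exec_Tab (n := m) (h := fun=> Leaf 0)); [by exec_run | by exec_auto | exact: leq_base1 |].
    by move=> *; exec_auto.
  by apply: enc_set_iota => i; rewrite inE.
- by apply: leq_base1; exact: ltnW hk.
- by move=> j _; exact: (deep_enc_set e 0).
- move=> j jK DD.
  have Dj : deep e 2 (Leaf j).
    by apply: deep_leaf_leq; apply: leq_base1; apply: leq_trans hk; rewrite ltnW // ltnW.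
  have D1 := deep_Node Dj (deep_Node (deep_Node (deep_Node Dk Dm) (deep_enc_draws e 0 omega))
               (deep_enc_set e 0 (best v w (candidate v w omega) j))).
  eapply exec_eq.
    eapply exec_Comp.
      eapply exec_Pair; [exact: H2 hf Hs jK D1 | by exec_auto].
    have D2 := deep_Node (deep_enc_set e 0 (candidate v w omega j))
       (deep_enc_set e 0 (best v w (candidate v w omega) j)).
    eapply exec_Cond; [by exec_auto | by move=> _; exec_auto | by move=> _; exec_auto].
  rewrite ho [tfst _]/= [tsnd _]/= !oracles0 !oracles1 /=; by case: leqP.
Qed.
End Programs.

(** * Value queries and codes for the scaled types *)

Definition pvalue (psim : prog) : prog :=
  Op Mul (Comp pscale (Pair (Fst (Snd (Snd Arg))) (Pair (Fst (Fst Arg)) (Comp pvmax (Fst Arg)))))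
    (Comp psim (Pair (Fst (Fst Arg)) (Pair (Fst (Snd (Fst Arg)))
       (Pair (Fst (Snd (Snd Arg))) (Pair (Fst (Snd (Snd (Snd Arg)))) (Lit 0)))))).

Lemma exec_pvalue psim c c1 : exists c', forall e k m (v w : valn m) rest y
    (l : 'I_k) (S : {set 'I_(k.-1 * m)}),
  fits e k v w -> simulates e k v w psim c ->
  deep e c1 (Node (Leaf k) (Node (Leaf m) rest)) -> deep e c1 y ->
  exec e c' (pvalue psim)
    (enc_seq [:: Node (Leaf k) (Node (Leaf m) rest); y; Leaf l; enc_set S])
    (Leaf (scale k (vmax v w) l * IT v w l S)).
Proof.
have [c2 H2] := exec_pvmax c1; have [c3 H3] := exec_pscale.
eexists => e k m v w rest y l S hf Hs Dx Dy; have [ho hk hm hkm hV] := hf.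
have Dl : deep e 2 (Leaf l).
  by apply: deep_leaf_leq; apply: leq_base1; apply: leq_trans hk; rewrite ltnW.
have D := deep_Node Dx (deep_Node Dy (deep_Node Dl (deep_Node (deep_enc_set e 0 S) (deep_bool e 0 false)))).
eapply exec_eq.
  eapply exec_Op.
    eapply exec_Comp.
      eapply exec_Pair; first by exec_auto.
      eapply exec_Pair; first by exec_auto.
      eapply exec_Comp; [by exec_auto | exact: H2 hf Dx].
    by apply: H3 => //; exact: ltnW.
  eapply exec_Comp; [by exec_auto | exact: Hs].
by [].
Qed.

(** If d is [quote p], this is [quote (Op Mul (Lit C) p)]: the tags are 6 for [Op], 2 for [Mul] and
    1 for [Lit]. Scaling a code thus needs no look inside it. *)
Definition scaled_code (C : nat) (d : tree) : tree :=
  enc_seq [:: Leaf 6; Leaf 2; enc_seq [:: Leaf 1; Leaf C]; d].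

Lemma bits_res_width o p x : bits (res (run o p x)) <= width (run o p x).
Proof. by case: p => *; rewrite /= ?leq_max leqnn ?orbT. Qed.

Lemma computes_scaled n C d (u z : valn n) s :
  computes d u s -> (forall S, z S = C * u S) ->
  computes (scaled_code C d) z (nbits C + s + 2).
Proof.
move=> [p [-> ps H]] zE; exists (Op Mul (Lit C) p); split=> //=; first by lia.
move=> S; have [r st wd] := H S; rewrite r /= zE; split=> //; first by lia.
(* The width of a run covers its result, so u(S) has at most s bits. *)
have := bits_res_width no_oracle p (enc_set S); rewrite r /= => hb.
by have := nbits_mul C (u S); lia.
Qed.

Definition pcodes (pcode : prog) : prog :=
  Tab (Fst Arg) (Pair (Pair (Fst Arg) pvmax) pcode)
    (Pair (Lit 6) (Pair (Lit 2) (Pair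
      (Pair (Lit 1) (Pair (Comp pscale (Pair (Fst Arg) (Fst (Snd Arg)))) (Lit 0)))
      (Pair (Nth (Fst Arg) (Snd (Snd Arg))) (Lit 0))))).

Lemma exec_pcodes pcode c c1 : exists c', forall e k m (v w : valn m) rest (d : 'I_k -> tree),
  let x := Node (Leaf k) (Node (Leaf m) rest) in
  fits e k v w -> deep e c1 x ->
  exec e c pcode x (enc_seq [seq d l | l <- enum 'I_k]) ->
  exec e c' (pcodes pcode) x
    (enc_seq [seq scaled_code (scale k (vmax v w) l) (d l) | l : 'I_k <- enum 'I_k]).
Proof.
have [c2 H2] := exec_pvmax c1; have [c3 H3] := exec_pscale.
eexists => e k m v w rest d x hf Dx Hd; have [ho hk hm hkm hV] := hf.
set ds := enc_seq _ in Hd.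
eapply exec_eq.
  eapply (exec_Tab (n := k) (env := Node (Node (Leaf k) (Leaf (vmax v w))) ds)
    (h := fun l => scaled_code (scale k (vmax v w) l) (tfst (iter l tsnd ds)))).
  - by exec_run.
  - by exec_run; [exact: H2 hf Dx | exact: Hd].
  - exact: leq_base1.
  - move=> l lk D; eapply exec_eq.
      eapply exec_Pair; first by exec_auto.
      eapply exec_Pair; first by exec_auto.
      eapply exec_Pair.
        eapply exec_Pair; first by exec_auto.
        eapply exec_Pair; last by exec_auto.
        eapply exec_Comp; first by exec_auto.
        by apply: H3 => //; exact: ltnW lk.
      eapply exec_Pair; last by exec_auto.
      eapply (exec_Nth (l := l)); [by exec_run | by exec_run |].
      by apply: leq_base1; apply: leq_trans hk; exact: ltnW.
    by [].
rewrite -map_enum_ord; congr enc_seq; apply: eq_map => l.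
by rewrite /ds tfst_iter_enc_seq (nth_map l) ?size_enum_ord // nth_ord_enum.
Qed.

(** The size of a program counts the bits of its literals and query indices. The remaining leaves
    are tags of at most 10, whose 4 bits fit because base^2 >= 9. *)
Lemma deep_quote e c p : 1 < c -> psize p <= base e ^ c * wid e -> deep e c (quote p).
Proof.
move=> hc.
have h n : n <= 10 -> nbits n <= base e ^ c * wid e.
  move=> hn; have := nbits_leq hn.
  have -> : nbits 10 = 4 by [].
  have := base_exp_leq e hc; have := base_expS e 1; rewrite expn1.
  by have := base_gt2 e; have := wid_gt0 e; nia.
pose h0 := h 0 isT.
pose hh := (h0, h 1 isT, h 2 isT, h 3 isT, h 4 isT, h 5 isT, h 6 isT, h 7 isT,
  h 8 isT, h 9 isT, h 10 isT).
elim: p => /=.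
- by rewrite !hh.
- by move=> n hn; rewrite !hh /= andbT; lia.
- by move=> p IHp q IHq hs; rewrite !hh /= IHp ?IHq //=; lia.
- by move=> p IHp hs; rewrite !hh /= IHp //=; lia.
- by move=> p IHp hs; rewrite !hh /= IHp //=; lia.
- by move=> p IHp hs; rewrite !hh /= IHp //=; lia.
- move=> a p IHp q IHq hs; rewrite !hh /= IHp ?IHq /= ?hh ?andbT //=; try lia.
  by case: a {hs}; rewrite /= !hh.
- by move=> p IHp q IHq r IHr hs; rewrite !hh /= IHp ?IHq ?IHr //=; lia.
- by move=> p IHp q IHq hs; rewrite !hh /= IHp ?IHq //=; lia.
- by move=> p IHp q IHq r IHr hs; rewrite !hh /= IHp ?IHq ?IHr //=; lia.
- by move=> i p IHp hs; rewrite !hh /= IHp //= ?andbT; lia.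
Qed.

Lemma deep_computes e c n (v : valn n) d s : 1 < c ->
  computes d v s -> s <= base e ^ c * wid e -> deep e c d.
Proof.
by move=> hc [p [-> hs _]] h; apply: deep_quote => //; apply: leq_trans hs h.
Qed.

(** * The two cost models *)

(** The leading constant is absorbed by c < 2^c <= base^c, at the price of doubling the exponent. *)
Lemma poly_bound_leq e c x : x < base e -> poly_bound c x <= base e ^ (2 * c).
Proof.
move=> hx; rewrite /poly_bound mul2n -addnn expnD; apply: leq_mul.
  apply: leq_trans (ltnW (ltn_expl c (isT : 1 < 2))) _.
  by case: c => // c; rewrite leq_exp2r // ltnW // base_gt2.
by case: c => // c; rewrite leq_exp2r.
Qed.

Lemma cost_of_budget e c x W o : x < base e -> W <= wid e ->
  budget o (poly_bound c x) (poly_bound c x * W) -> cost e (2 * c) o.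
Proof.
move=> hx hW [hs hq hw]; have h := poly_bound_leq c hx.
split; [exact: leq_trans h | exact: leq_trans h |].
by apply: leq_trans hw _; exact: leq_mul.
Qed.

Lemma budget_of_cost e c c' x o : base e = x.+1 -> c < c' -> cost e c o ->
  budget o (poly_bound c' x) (poly_bound c' x * wid e).
Proof.
move=> hx hc [hs hq hw]; have h : base e ^ c <= poly_bound c' x.
  rewrite /poly_bound -hx; apply: leq_trans (base_exp_leq e (ltnW hc)) _.
  by rewrite leq_pmull //; case: c' hc.
split; [exact: leq_trans hs h | exact: leq_trans hq h |].
by apply: leq_trans hw _; rewrite leq_mul2r h orbT.
Qed.

(** For explicit input [wid] is s, which is below the base; the factor [wid] then costs one more
    power. *)
Lemma budget_of_cost_wid e c c' x o : base e = x.+1 -> wid e <= base e -> c < c' ->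
  cost e c o -> budget o (poly_bound c' x) (poly_bound c' x).
Proof.
move=> hx hw hc [hs hq hwd].
have h : base e ^ c' <= poly_bound c' x.
  by rewrite /poly_bound -hx leq_pmull //; case: c' hc.
have h' := leq_trans (base_exp_leq e (ltnW hc)) h.
split; [exact: leq_trans hs h' | exact: leq_trans hq h' |].
apply: leq_trans hwd _; apply: leq_trans (leq_mul (leqnn _) hw) _.
by rewrite -expnSr; apply: leq_trans h; exact: base_exp_leq.
Qed.

Lemma valuation_mono n (v : valn n) (S T : {set 'I_n}) : is_valuation v -> S \subset T -> v S <= v T.
Proof. by case=> _ h _ /finset.setUidPr <-; exact: h. Qed.

Lemma oracles_leq m (v w : valn m) i x : is_valuation v -> is_valuation w ->
  oracles v w i x <= vmax v w.
Proof.
move=> hv hw; rewrite /oracles /vmax; case: eqP => _.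
  by apply: leq_trans (leq_maxl _ _); apply: valuation_mono => //; exact: finset.subsetT.
by apply: leq_trans (leq_maxr _ _); apply: valuation_mono => //; exact: finset.subsetT.
Qed.

Lemma oracle_setting k m (v w : valn m) : 1 < k -> 0 < m ->
  is_valuation v -> is_valuation w ->
  exists e, [/\ fits e k v w, base e = (k * m).+1 & wid e = nbits (vmax v w)].
Proof.
move=> hk hm hv hw.
have hN : 2 < (k * m).+1 by nia.
have hW : 0 < nbits (vmax v w) by [].
have ho i x : nbits (oracles v w i x) <= nbits (vmax v w).
  exact: nbits_leq (oracles_leq i x hv hw).
exists (Setting hN hW ho); split=> //; split=> //=; nia.
Qed.

Lemma computes_nbits n (v : valn n) d s S : computes d v s -> nbits (v S) <= s.
Proof.
move=> [p [_ _ /(_ S) [hr _ hw]]]; apply: leq_trans hw.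
by have := bits_res_width no_oracle p (enc_set S); rewrite hr.
Qed.

(** The values of v and w have at most s bits because the given codes compute them on numbers of at
    most s bits. *)
Lemma explicit_setting k m s (v w : valn m) dv dw : 1 < k -> 0 < m ->
  is_valuation v -> is_valuation w -> computes dv v s -> computes dw w s ->
  exists e, [/\ fits e k v w, base e = (k * m * s).+1 & wid e = s].
Proof.
move=> hk hm hv hw cv cw.
have hV : nbits (vmax v w) <= s.
  by rewrite /vmax; case: (leqP (v _)) => _; [exact: computes_nbits cw | exact: computes_nbits cv].
have hs : 0 < s by exact: leq_trans hV.
have h2 : 2 <= k * m by nia.
have hkm : k * m <= k * m * s by rewrite leq_pmulr.
have hN : 2 < (k * m * s).+1 by rewrite ltnS (leq_trans h2).
have ho i x : nbits (oracles v w i x) <= s.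
  exact: leq_trans (nbits_leq (oracles_leq i x hv hw)) hV.
exists (Setting hN hs ho); split=> //; split=> //=; apply: leqW; apply: leq_trans hkm; nia.
Qed.

(** * Truncated valuations and their copies *)

Lemma valuation0 n (v : valn n) : is_valuation v -> v finset.set0 = 0.
Proof. by case. Qed.

Lemma valuation_gt0 n (v : valn n) (S : {set 'I_n}) : is_valuation v -> S != finset.set0 -> 0 < v S.
Proof. by case=> _ _; exact. Qed.

Lemma item_trunc_geq n y (u : valn n) (S T : {set 'I_n}) :
  T \subset S -> #|T| <= y -> u T <= item_trunc y u S.
Proof.
move=> TS Ty; rewrite ffunE; apply: (@leq_bigmax_cond _ _ (fun T : {set 'I_n} => u T)).
by rewrite TS.
Qed.

Lemma item_trunc_ex n y (u : valn n) (S : {set 'I_n}) :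
  exists T : {set 'I_n}, [/\ T \subset S, #|T| <= y & item_trunc y u S = u T].
Proof.
have h0 : (finset.set0 \subset S) && (#|(finset.set0 : {set 'I_n})| <= y).
  by rewrite finset.sub0set cards0.
rewrite ffunE (bigop.bigmax_eq_arg finset.set0 h0); case: arg_maxnP => // T /andP[? ?] _.
by exists T.
Qed.

Lemma item_trunc_mono n y (u : valn n) (S T : {set 'I_n}) :
  S \subset T -> item_trunc y u S <= item_trunc y u T.
Proof.
move=> ST; have [X [XS Xy ->]] := item_trunc_ex y u S.
by apply: item_trunc_geq => //; exact: fintype.subset_trans ST.
Qed.

(** A nonempty set contains a singleton, which survives truncation at y > 0. *)
Lemma is_valuation_trunc n y (u : valn n) :
  0 < y -> is_valuation u -> is_valuation (item_trunc y u).
Proof.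
move=> y0 hu; split.
- have [T [T0 _ ->]] := item_trunc_ex y u finset.set0.
  by move: T0; rewrite finset.subset0 => /eqP->; exact: valuation0.
- by move=> S T; apply: item_trunc_mono; exact: finset.subsetUl.
- move=> S /finset.set0Pn[x xS]; apply: (@leq_trans (u [set x]%SET)).
    by apply: valuation_gt0 => //; apply/finset.set0Pn; exists x; rewrite finset.inE.
  by apply: item_trunc_geq; rewrite ?cards1 // finset.sub1set.
Qed.

(** * Greedy deletion for truncated valuations *)

Section Shrink.
Variables (n : nat) (f : {set 'I_n} -> nat).
Hypothesis f_mono : forall S T : {set 'I_n}, S \subset T -> f S <= f T.
Implicit Types S : {set 'I_n}.

Lemma shrinkS_sub S j : shrink f S j.+1 \subset shrink f S j.
Proof. by rewrite /=; case: ifP => // _; exact: finset.subsetDl. Qed.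

Lemma shrink_sub S i j : i <= j -> shrink f S j \subset shrink f S i.
Proof.
move=> /subnK <-; elim: (j - i) => // d IH.
by apply: fintype.subset_trans IH; rewrite addSn; exact: shrinkS_sub.
Qed.

Lemma shrink_value S j : f (shrink f S j) = f S.
Proof.
elim: j => //= j IH; case: ifP => // h.
apply/eqP; rewrite -IH eqn_leq h f_mono //; exact: finset.subsetDl.
Qed.

(** One pass is enough: if x was kept in its round, deleting it lowered the value then. The final
    set is contained in the set of that round, so by monotonicity deleting x lowers the value
    still. *)
Lemma shrink_minimal S (x : 'I_n) :
  x \in shrink f S n -> f (shrink f S n :\ x) < f S.
Proof.
move=> xS; have xS' : x \in shrink f S x.+1.
  by apply: (fintype.subsetP (shrink_sub S (ltn_ord x))).
have xS0 : x \in shrink f S x := fintype.subsetP (shrinkS_sub S x) x xS'.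
move: xS' => /=; case: ifP => [_|]; first by rewrite !inE eqxx.
move=> /negbT; rewrite -ltnNge shrink_value => h _.
apply: leq_ltn_trans h; apply: f_mono; apply/fintype.subsetP=> z.
rewrite !inE => /andP[zx zS]; rewrite (inj_eq val_inj) zx /=.
by apply: (fintype.subsetP (shrink_sub S (ltnW (ltn_ord x)))).
Qed.
End Shrink.

(** The truncated value of S' is attained at some T inside S' with at most y items. An item of S'
    outside T could be deleted without loss, against minimality, so T is S' itself. *)
Lemma shrink_trunc n y (u : valn n) (S : {set 'I_n}) :
  let S' := shrink (item_trunc y u) S n in
  [/\ S' \subset S, #|S'| <= y & item_trunc y u S = u S'].
Proof.
set f := item_trunc y u => S'.
have fm A B := @item_trunc_mono n y u A B.
have fS : f S' = f S := shrink_value fm S n.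
have sub : S' \subset S := shrink_sub f S (leq0n n).
have [T [TS Ty fT]] := item_trunc_ex y u S'.
suff TE : T = S' by split=> //; [rewrite -TE | rewrite -/f -fS fT TE].
apply/eqP; rewrite finset.eqEsubset TS; apply/fintype.subsetP=> x xS.
apply/negPn/negP => xT; have := shrink_minimal fm xS.
rewrite -/S' -/f -fS /f fT ltnNge => /negP; apply; apply: item_trunc_geq => //.
apply/fintype.subsetP=> z zT; rewrite !inE (fintype.subsetP TS) // andbT.
by apply: contraNneq xT => <-.
Qed.

(** * Disjoint unions of copies *)

Lemma copy_at_mono n m (S T : {set 'I_n}) i : S \subset T -> copy_at m S i \subset copy_at m T i.
Proof.
move=> ST; apply/fintype.subsetP=> j; rewrite !inE => /existsP[x /andP[xS e]].
by apply/existsP; exists x; rewrite (fintype.subsetP ST).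
Qed.

Lemma copy_at0 n m i : copy_at m (finset.set0 : {set 'I_n}) i = finset.set0.
Proof. by apply/finset.setP=> j; rewrite !inE; apply/existsP => -[x]; rewrite inE. Qed.

(** The iterated disjoint union of f 0, ..., f (K - 1). *)
Definition concat K m (f : nat -> valn m) : valn (K * m) :=
  [ffun S : {set 'I_(K * m)} => \sum_(i < K) f i (copy_at m S i)].

Lemma is_valuation_concat K m (f : nat -> valn m) :
  (forall i, i < K -> is_valuation (f i)) -> is_valuation (concat K f).
Proof.
move=> hf; split.
- by rewrite ffunE big1 // => i _; rewrite copy_at0 valuation0 //; exact: hf.
- move=> S T; rewrite !ffunE; apply: leq_sum => i _.
  by apply: valuation_mono; [exact: hf | apply: copy_at_mono; exact: finset.subsetUl].
- move=> S /finset.set0Pn[x xS]; have xKm := ltn_ord x.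
  have m0 : 0 < m by move: (nat_of_ord x) xKm => y; case: (m) => //; rewrite muln0.
  have iK : x %/ m < K by rewrite ltn_divLR.
  rewrite ffunE (bigD1 (Ordinal iK)) //=; apply: leq_trans (leq_addr _ _).
  apply: valuation_gt0; [exact: hf | apply/finset.set0Pn].
  have jm : x %% m < m by rewrite ltn_mod.
  exists (Ordinal jm); rewrite inE; apply/existsP; exists x.
  by rewrite xS /= -divn_eq.
Qed.

Definition scalev n c (v : valn n) : valn n := [ffun S => c * v S].

Lemma is_valuation_scale n c (v : valn n) : 0 < c -> is_valuation v -> is_valuation (scalev c v).
Proof.
move=> c0 hv; split.
- by rewrite ffunE valuation0 // muln0.
- by move=> S T; rewrite !ffunE leq_mul2l; case: hv => _ -> _; rewrite orbT.
- by move=> S S0; rewrite ffunE muln_gt0 c0 valuation_gt0.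
Qed.

Section Closure.
Variable V : val_class.
Hypothesis HV : valuation_class V.

Lemma class_scale n c (v : valn n) : closed_scaling V -> 0 < c -> V v -> V (scalev c v).
Proof.
move=> Hs c0 hv; apply: (Hs n v (scalev c v) c%:R%R) => //.
- by move=> S; rewrite ffunE natrM.
- exact: is_valuation_scale (HV hv).
Qed.

(** Induction splits off the first copy, the left part of a binary union. It starts from one copy,
    where f 0 itself is in the class. *)
Lemma class_concat K m (f : nat -> valn m) : closed_dunion V ->
  (forall i, i <= K -> V (f i)) -> V (concat K.+1 f).
Proof.
move=> Hu; elim: K f => [|K IH] f hf.
  (* The dimensions m and [1 * m] are not convertible, hence the transport along an equality. *)
  have cast n (e : m = n) (u : valn n) : (forall S, u S = f 0 [set i | cast_ord e i \in S]) -> V u.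
    case: n / e u => u hu; suff -> : u = f 0 by exact: hf.
    apply/ffunP=> S; rewrite hu; congr (f 0 _); apply/finset.setP=> i.
    by rewrite inE cast_ord_id.
  apply: (cast _ (esym (mul1n m))) => S; rewrite ffunE big_ord1; congr (f 0 _).
  apply/finset.setP=> i; rewrite !inE; apply/existsP/idP => [[x /andP[xS /eqP xe]]|iS].
    by rewrite (_ : cast_ord _ i = x) //; apply: val_inj; rewrite /= xe.
  by exists (cast_ord (esym (mul1n m)) i); rewrite iS /=.
have := Hu m (K.+1 * m) (f 0) (concat K.+1 (fun i => f i.+1)) (hf 0 isT) (IH _ _).
set d := dunion _ _ => hd; suff -> : concat K.+2 f = d by apply: hd => i iK; exact: hf.
apply/ffunP=> S; rewrite !ffunE big_ord_recl; congr (_ + _).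
  congr (f 0 _); apply/finset.setP=> i; rewrite !inE; apply/existsP/idP => [[x /andP[xS /eqP xe]]|iS].
    by rewrite (_ : lshift _ i = x) //; apply: val_inj; rewrite /= xe.
  by exists (lshift (K.+1 * m) i); rewrite iS /=.
apply: eq_bigr => j _; congr (f _ _); apply/finset.setP=> i; rewrite !inE.
apply/existsP/existsP => -[x /andP[xS /eqP xe]].
  have mx : m <= x by rewrite xe /= /bump mulSn; lia.
  have xlt : x - m < K.+1 * m by rewrite ltn_subLR // -mulSn.
  have xE : rshift m (Ordinal xlt) = x by apply: val_inj; rewrite /= subnKC.
  exists (Ordinal xlt); rewrite inE xE xS /= xe /= /bump mulSn; apply/eqP; lia.
by exists (rshift m x); move: xS; rewrite inE => -> /=; rewrite xe /= /bump mulSn; apply/eqP; lia.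
Qed.
End Closure.

(** * Items and their copies *)

Section Items.
Variables K m : nat.
Implicit Types (i : 'I_K) (j : 'I_m) (S : {set 'I_(K * m)}) (T : {set 'I_m}).

Lemma item_ltn i j : i * m + j < K * m.
Proof.
have : i.+1 * m <= K * m by rewrite leq_mul2r ltn_ord orbT.
by rewrite mulSn; have := ltn_ord j; lia.
Qed.

Definition item i j : 'I_(K * m) := Ordinal (item_ltn i j).

Lemma item_inj i i' j j' : item i j = item i' j' -> i = i' /\ j = j'.
Proof.
move=> /(congr1 val) /= e; have m0 : 0 < m by apply: leq_ltn_trans (ltn_ord j).
have ii : i = i' :> nat.
  have := congr1 (divn^~ m) e; rewrite !divnMDl // !divn_small ?ltn_ord //.
  by rewrite !addn0.
by split; apply: val_inj => //=; move: e; rewrite ii => /addnI.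
Qed.

Lemma mem_copy_at S i j : (j \in copy_at m S i) = (item i j \in S).
Proof.
rewrite inE; apply/existsP/idP => [[x /andP[xS /eqP xe]]|iS].
  by rewrite (_ : item i j = x) //; apply: val_inj.
by exists (item i j); rewrite iS /=.
Qed.

Definition place i T : {set 'I_(K * m)} := [set item i j | j in T]%SET.

Lemma card_place i T : #|place i T| <= m.
Proof. by apply: leq_trans (leq_imset_card _ _) _; rewrite -[X in _ <= X]card_ord max_card. Qed.

Lemma copy_at_place i i' T : copy_at m (place i T) i' = if i == i' then T else finset.set0.
Proof.
apply/finset.setP=> j; rewrite mem_copy_at; apply/imsetP/idP.
  by case=> j' jT /item_inj[-> ->]; rewrite eqxx.
by case: eqP => [->|_]; rewrite ?inE // => jT; exists j.
Qed.

(** The pairs (i, j) with [item i j] in S are counted, and [item] is injective on pairs. *)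
Lemma sum_card_copy_at S : \sum_(i < K) #|copy_at m S i| <= #|S|.
Proof.
rewrite (eq_bigr (fun i => \sum_(j | item i j \in S) 1)); last first.
  by move=> i _; rewrite -sum1_card; apply: eq_bigl => j; rewrite mem_copy_at.
rewrite pair_big_dep /= sum1_card.
rewrite -(card_image (f := fun p : 'I_K * 'I_m => item p.1 p.2)); last first.
  by move=> [i j] [i' j'] /= /item_inj[-> ->].
by apply/subset_leq_card/fintype.subsetP=> x /fintype.imageP[p pS ->].
Qed.
End Items.

(** * The valuations of the list IT *)

Section IT.
Variables (k m : nat) (v w : valn m).
Hypotheses (hv : is_valuation v) (hw : is_valuation w).
Implicit Types (l : 'I_k) (S : {set 'I_(k.-1 * m)}) (T : {set 'I_m}).

Lemma IT_sumE l :
  IT_sum v w l = concat k.-1 (fun i => scalev (k + i.+1) (if l <= i then v else w)).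
Proof.
apply/ffunP=> S; rewrite !ffunE; apply: eq_bigr => i _.
by rewrite ffunE; case: ifP.
Qed.

Lemma is_valuation_IT_sum l : is_valuation (IT_sum v w l).
Proof.
rewrite IT_sumE; apply: is_valuation_concat => i _.
by apply: is_valuation_scale; [rewrite addnS | case: ifP].
Qed.

Lemma is_valuation_IT l : 0 < m -> is_valuation (IT v w l).
Proof. by move=> m0; apply: is_valuation_trunc => //; exact: is_valuation_IT_sum. Qed.

Lemma IT_class (V : val_class) l :
  valuation_class V -> closed_scaling V -> closed_dunion V -> closed_truncation V ->
  1 < k -> 0 < m -> V m v -> V m w -> V _ (IT v w l).
Proof.
move=> HV Hs Hu Ht k1 m0 Vv Vw; apply: Ht; last exact: is_valuation_IT.
rewrite IT_sumE; case: k k1 l => [|[|K]] // _ l; apply: class_concat => // i _.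
by apply: class_scale => //; case: ifP.
Qed.

(** A set inside one copy has at most m items, so truncation leaves its value alone. *)
Lemma IT_place l (i : 'I_k.-1) T :
  IT v w l (place i T) = (k + i.+1) * (if l <= i then v T else w T).
Proof.
have -> : IT v w l (place i T) = IT_sum v w l (place i T).
  have mono A B := @valuation_mono _ _ A B (is_valuation_IT_sum l).
  apply/eqP; rewrite eqn_leq item_trunc_geq ?card_place //.
  by have [T' [T'S _ ->]] := item_trunc_ex m (IT_sum v w l) (place i T); rewrite mono.
rewrite ffunE (bigD1 i) //= big1 => [|j ji].
  by rewrite addn0 [copy_of _ _]copy_at_place eqxx.
rewrite [copy_of _ _]copy_at_place eq_sym (negbTE ji).
by rewrite !valuation0 // if_same muln0.
Qed.

(* The item sets of the copies other than l contribute equally to both sums. *)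
Lemma IT_diff l l' S : l' = l.+1 :> nat ->
  let T := copy_at m (shrink (IT v w l) S (k.-1 * m)) l in
  IT v w l S + (k + l.+1) * w T <= IT v w l' S + (k + l.+1) * v T.
Proof.
move=> ll'; have [S'S S'm E] := shrink_trunc m (IT_sum v w l) S.
set S' := shrink _ _ _ in S'S S'm E *; set T := copy_at _ _ _ => /=.
have lk : l < k.-1 by have := ltn_ord l'; lia.
(* S' was minimised for l, but having at most m items it also bounds the truncated value for l' from
   below. *)
have E' : IT_sum v w l' S' <= IT v w l' S by exact: item_trunc_geq.
rewrite [IT v w l S]E; apply: leq_trans (leq_add E' (leqnn _)).
rewrite !ffunE (bigD1 (Ordinal lk)) //= [X in _ <= X + _](bigD1 (Ordinal lk)) //=.
rewrite leqnn ll' ltnn.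
rewrite [copy_of _ _](_ : _ = T) // [X in X <= _]addnAC [X in _ <= X]addnAC.
rewrite (addnC ((k + l.+1) * w T)) leq_add2l; apply/eq_leq/eq_bigr => j jl.
have {}jl : (j : nat) != l by [].
by have -> : (l.+1 <= j) = (l <= j) by lia.
Qed.

Lemma IT_le_vmax l S : IT v w l S <= k.-1 * (2 * k).-1 * vmax v w.
Proof.
have [T [_ _ ->]] := item_trunc_ex m (IT_sum v w l) S.
rewrite ffunE -mulnA -[k.-1 in X in _ <= X](card_ord k.-1) -sum_nat_const.
apply: leq_sum => i _; apply: leq_mul; first by have := ltn_ord i; lia.
case: ifP => _; rewrite /vmax leq_max; apply/orP; [left | right];
  by apply: valuation_mono => //; exact: finset.subsetT.
Qed.

(** In the last entry every copy carries w, and a set of at most m items meets at most m copies.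
    This is the purpose of truncation: m replaces the number k - 1 of copies. *)
Lemma IT_last_le l S : l = k.-1 :> nat ->
  IT v w l S <= 2 * k * m * w [set: 'I_m]%SET.
Proof.
move=> lk; have [T [_ Tm ->]] := item_trunc_ex m (IT_sum v w l) S.
(* Each copy is charged w([m]) once for every item of T in it; empty copies contribute nothing. *)
rewrite ffunE; apply: (@leq_trans (\sum_(i < k.-1) 2 * k * w [set: 'I_m]%SET * #|copy_at m T i|)).
  apply: leq_sum => i _; have -> : (l <= i) = false by have := ltn_ord i; lia.
  rewrite -mulnA.
  apply: leq_mul; first by have := ltn_ord i; lia.
  rewrite [copy_of _ _](_ : _ = copy_at m T i) //.
  have [->|/finset.set0Pn[x xT]] := eqVneq (copy_at m T i) finset.set0.
    by rewrite valuation0.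
  apply: leq_trans (leq_pmulr _ _); last by rewrite card_gt0; apply/finset.set0Pn; exists x.
  by apply: valuation_mono => //; exact: finset.subsetT.
rewrite -big_distrr /= -!mulnA !leq_mul2l [X in _ || (_ || X)](_ : _ = true) ?orbT //.
rewrite mulnC; apply: leq_mul => //; exact: leq_trans (sum_card_copy_at T) Tm.
Qed.
End IT.

(** * Growth of the factors *)

Section Scale.
Variables k V : nat.
Hypotheses (k1 : 1 < k) (V0 : 0 < V).

Lemma scale_gt0 l : 0 < scale k V l.
Proof. by case: l => //= l; rewrite !muln_gt0 V0 expn_gt0 /= !muln_gt0 V0 (ltnW k1). Qed.

Lemma scaleS l : 0 < l -> scale k V l.+1 = 2 * k * V * scale k V l.
Proof. by case: l => //= l _; rewrite expnS mulnCA. Qed.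

Lemma scaleS_ge l : 2 * V * scale k V l <= scale k V l.+1.
Proof.
case: l => [|l]; first by rewrite /= expn0 !muln1.
rewrite [X in _ <= X]scaleS // leq_mul2r; apply/orP; right.
by rewrite leq_mul2r leq_pmulr ?orbT // ltnW.
Qed.

Lemma scale_lt l l' : l < l' -> 2 * V * scale k V l <= scale k V l'.
Proof.
elim: l' => // l' IH; rewrite ltnS leq_eqVlt => /predU1P[->|/IH h]; first exact: scaleS_ge.
apply: leq_trans h _; apply: leq_trans (scaleS_ge l').
by rewrite leq_pmull // muln_gt0.
Qed.

Lemma scale_le l : scale k V l <= (2 * k * V) ^ l.
Proof.
case: l => // l; rewrite /= expnS leq_mul2r; apply/orP; right.
by rewrite leq_mul2r leq_pmulr ?orbT // ltnW.
Qed.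

(** One factor 2 V of C_(l+1) combines with the bound on the valuation into at most (2 k V)^2, so
    the total exponent is l + 2 <= k. The missing k in the first ratio pays for the number of
    copies. *)
Lemma scale_mul_le l : l < k ->
  scale k V l * (k.-1 * (2 * k).-1 * V) <= (2 * k * V) ^ k.
Proof.
have B0 : 0 < 2 * k * V by rewrite !muln_gt0 V0 (ltnW k1).
have h : 2 * V * (k.-1 * (2 * k).-1 * V) <= (2 * k * V) ^ 2.
  have : k.-1 * (2 * k).-1 <= k * (2 * k) by apply: leq_mul; lia.
  rewrite expnS expn1; move: (k.-1 * _) => x hx.
  have : x * (V * V) <= k * (2 * k) * (V * V) by rewrite leq_mul2r hx orbT.
  lia.
case: l => [_|l lk].
  rewrite mul1n; apply: leq_trans (_ : 2 * V * (k.-1 * (2 * k).-1 * V) <= _).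
    by rewrite leq_pmull // muln_gt0.
  by apply: leq_trans h _; rewrite leq_pexp2l.
rewrite /= mulnAC; apply: leq_trans (leq_mul h (leqnn _)) _.
by rewrite -expnD leq_pexp2l.
Qed.
End Scale.

(** * Revenue of menus *)

Section Revenue.
Variable R : realType.
Local Open Scope ring_scope.

(** Summation by parts; over the rationals it also shows that the probabilities add up to 1. *)
Lemma abel_sum (A : comNzRingType) (Q p : nat -> A) K :
  \sum_(l < K.+1) (Q l - Q l.+1) * p l =
  Q 0%N * p 0%N + \sum_(l < K) Q l.+1 * (p l.+1 - p l) - Q K.+1 * p K.
Proof.
elim: K => [|K IH]; first by rewrite big_ord_recl !big_ord0 addr0 mulrBl addr0.
by rewrite big_ord_recr /= IH [in RHS]big_ord_recr /=; ring.
Qed.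

(** For b l = u_l(S_l) and a l = u_(l+1)(S_l), this passes from differences between two sets under
    one valuation to differences between two valuations on one set. *)
Lemma shift_sum (a b : nat -> R) K :
  b 0%N + \sum_(l < K) (b l.+1 - a l) = \sum_(l < K) (b l - a l) + b K.
Proof.
elim: K => [|K IH]; first by rewrite !big_ord0 addr0 add0r.
by rewrite !big_ord_recr /= addrA IH; ring.
Qed.

Definition point n (S : {set 'I_n}) : {set 'I_n} -> R := fun T => (T == S)%:R.

Lemma is_dist_point n (S : {set 'I_n}) : is_dist (point S).
Proof.
split=> [T|]; first exact: ler0n.
by rewrite (bigD1 S) //= /point eqxx big1 ?addr0 // => T /negbTE->.
Qed.

Lemma ev_point n (v : valn n) S : ev v (point S) = (v S)%:R.
Proof.
rewrite /ev (bigD1 S) //= /point eqxx mul1r big1 ?addr0 // => T /negbTE->.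
by rewrite mul0r.
Qed.

Lemma ev_scale n (u z : valn n) c p :
  (forall S, z S = (c * u S)%N) -> ev z p = c%:R * ev u p :> R.
Proof.
move=> zE; rewrite /ev mulr_sumr; apply: eq_bigr => S _.
by rewrite zE natrM; ring.
Qed.

Lemma ler_ev_const n (v : valn n) p (b : nat) :
  is_dist p -> (forall S, (v S <= b)%N) -> ev v p <= b%:R :> R.
Proof.
move=> [p0 p1] vb; rewrite -[leRHS]mul1r -[X in _ <= X * _]p1 mulr_suml; apply: ler_sum => S _.
by apply: ler_wpM2l => //; rewrite ler_nat.
Qed.

(** * Chains of scaled types *)

Section Chain.
Variables (n K : nat) (z : {ffun 'I_K.+1 -> valn n}).
Variables (u : nat -> valn n) (C : nat -> nat) (q : {ffun 'I_K.+1 -> rat}).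
Hypothesis C_gt0 : forall l, (0 < C l)%N.
Hypothesis zE : forall l S, z l S = (C l * u l S)%N.
(** The probability of type l or higher; the value 0 beyond K makes the last probability a
    difference like the others. *)
Let Q (l : nat) : R := if (l <= K)%N then (C l)%:R^-1 else 0.
Hypothesis qE : forall l, ratr (q l) = Q l - Q l.+1.

Let QK : Q K.+1 = 0.
Proof. by rewrite /Q ltnn. Qed.

Let QC l : (l <= K)%N -> Q l * (C l)%:R = 1.
Proof. by move=> lK; rewrite /Q lK mulVf // pnatr_eq0 -lt0n. Qed.

Let Q_ge0 l : 0 <= Q l.
Proof. by rewrite /Q; case: ifP => // _; rewrite invr_ge0 ler0n. Qed.

Let zi l : (l <= K)%N -> forall S, z (inord l) S = (C l * u l S)%N.
Proof. by move=> lK S; rewrite zE inordK. Qed.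

Lemma revenue_chain (M : menu R n K.+1) : revenue q M =
  Q 0%N * price M (inord 0) +
  \sum_(l < K) Q l.+1 * (price M (inord l.+1) - price M (inord l)).
Proof.
have := abel_sum Q (fun l => price M (inord l)) K.
rewrite QK mul0r subr0 => <-; apply: eq_bigr => l _.
by rewrite qE inord_val.
Qed.

(** The price of type 0 is bounded by participation, and each increment by the constraint of type l
    + 1 against the offer to l. The weight Q_l cancels the scaling C_l. *)
Lemma revenue_le (M : menu R n K.+1) : feasible z M ->
  revenue q M <= \sum_(l < K) (ev (u l) (alloc M (inord l)) - ev (u l.+1) (alloc M (inord l)))
                 + ev (u K) (alloc M (inord K)).
Proof.
move=> [_ IC IR].
pose a l := ev (u l.+1) (alloc M (inord l)); pose b l := ev (u l) (alloc M (inord l)).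
rewrite -[leRHS](shift_sum a b) revenue_chain; apply: lerD.
  have := IR (inord 0); rewrite subr_ge0 (ev_scale _ (zi (leq0n K))) => h.
  by apply: le_trans (ler_wpM2l (Q_ge0 0) h) _; rewrite mulrA QC // mul1r.
apply: ler_sum => l _; have lK : (l.+1 <= K)%N by [].
have := IC (inord l.+1) (inord l); rewrite !(ev_scale _ (zi lK)) => h.
have {}h : price M (inord l.+1) - price M (inord l) <= (C l.+1)%:R * (b l.+1 - a l).
  by rewrite mulrBr /a /b; lra.
by apply: le_trans (ler_wpM2l (Q_ge0 l.+1) h) _; rewrite mulrA QC // mul1r.
Qed.

(* Local downward constraints bind; the hypotheses on [D] extend local
   incentive compatibility to global one. *)
Lemma revenue_chain_ex (S : nat -> {set 'I_n}) :
  let D i l : R := (C i.+1 * u i.+1 (S l))%:R - (C i * u i (S l))%:R in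
  (forall i, (i < K)%N -> 0 <= D i i) ->
  (forall i l, (i < K)%N -> (l < i)%N -> D i l <= D i i) ->
  (forall i l, (i < l <= K)%N -> D i i <= D i l) ->
  exists M : menu R n K.+1, feasible z M /\ revenue q M =
    \sum_(l < K) ((u l (S l))%:R - (u l.+1 (S l))%:R) + (u K (S K))%:R.
Proof.
move=> D D0 Dlt Dgt.
(* The utility left to type l if type 0 keeps nothing and the local downward constraints bind. *)
pose U l : R := \sum_(0 <= i < l) D i i.
pose M := Menu (fun l : 'I_K.+1 => point (S l))
  (fun l : 'I_K.+1 => (C l * u l (S l))%:R - U l).
have Ucat i j : (i <= j)%N -> U j = U i + \sum_(i <= l < j) D l l.
  by move=> ij; rewrite /U -big_cat_nat.
have Dcat i j l : (i <= j)%N ->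
    \sum_(i <= h < j) D h l = (C j * u j (S l))%:R - (C i * u i (S l))%:R.
  by move=> ij; rewrite telescope_sumr.
exists M; split; first split.
- by move=> l; exact: is_dist_point.
- move=> l j; rewrite /= !ev_point !zE.
  (* Both sides telescope into sums over the types between j and l, of [D i j] and of [D i i], which
     are compared term by term. *)
  suff : (C l * u l (S j))%:R - (C j * u j (S j))%:R <= U l - U j by lra.
  have [jl|lj] := leqP j l.
    rewrite (Ucat _ _ jl) -Dcat // addrAC subrr add0r big_nat_cond [leRHS]big_nat_cond.
    apply: ler_sum => i /andP[/andP[ji il] _].
    have iK : (i < K)%N by apply: leq_trans il _; rewrite -ltnS.
    by move: ji; rewrite leq_eqVlt => /predU1P[->//|ji]; exact: Dlt.
  rewrite (Ucat _ _ (ltnW lj)) opprD addrA subrr add0r -opprB -Dcat ?(ltnW lj) // lerN2.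
  rewrite big_nat_cond [leRHS]big_nat_cond.
  by apply: ler_sum => i /andP[/andP[li ij] _]; apply: Dgt; rewrite ij -ltnS /=.
- move=> l; rewrite /= ev_point zE opprB addrC subrK.
  rewrite /U big_nat_cond; apply: sumr_ge0 => i /andP[/andP[_ il] _].
  by apply: D0; apply: leq_trans il _; rewrite -ltnS.
rewrite revenue_chain -(shift_sum (fun l => (u l.+1 (S l))%:R) (fun l => (u l (S l))%:R)).
congr (_ + _).
  by rewrite /M /= inordK // /U big_geq // subr0 natrM mulrA QC // mul1r.
apply: eq_bigr => l _; rewrite /M /= !inordK ?ltnS //; last exact: ltnW.
rewrite (Ucat _ _ (leqnSn l)) big_nat1 /D.
set x := (C l * _)%:R; rewrite (_ : _ - _ = (C l.+1)%:R * ((u l.+1 (S l.+1))%:R - (u l.+1 (S l))%:R)).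
  by rewrite mulrA QC // mul1r.
by rewrite !natrM; ring.
Qed.

End Chain.

(** [OPT] is a real supremum, which dominates the revenues once they are bounded above; b serves as
    that bound. *)
Lemma revenue_le_OPT n k (z : {ffun 'I_k -> valn n}) (q : {ffun 'I_k -> rat}) (b : R) :
  (forall M : menu R n k, feasible z M -> revenue q M <= b) ->
  forall M : menu R n k, feasible z M -> revenue q M <= OPT R z q.
Proof.
move=> hb M fM; apply: ub_le_sup; last by exists M.
by exists b => _ [M' fM' <-]; exact: hb.
Qed.

(** * Drawing sets independently *)

Section Output.
Variables (n k m : nat) (M : menu R n k).
Hypothesis dM : forall l, is_dist (alloc M l).
Implicit Types omega : {ffun 'I_k -> {set 'I_n}}.

Let weight omega := \prod_l alloc M l (omega l).

Lemma weight_ge0 omega : 0 <= weight omega.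
Proof. by apply: prodr_ge0 => l _; case: (dM l). Qed.

(** The l-th marginal of the product law: the sum of products factors, and all factors but the l-th
    are 1. *)
Lemma sum_weight_marginal l (F : {set 'I_n} -> R) :
  \sum_omega weight omega * F (omega l) = \sum_S alloc M l S * F S.
Proof.
pose G i S := alloc M i S * (if i == l then F S else 1).
rewrite (eq_bigr (fun omega : {ffun 'I_k -> {set 'I_n}} => \prod_i G i (omega i))); last first.
  move=> omega _; rewrite /G big_split /=; congr (_ * _).
  by rewrite (bigD1 l) //= eqxx big1 ?mulr1 // => i /negbTE->.
rewrite -(bigA_distr_bigA G) (bigD1 l) //= [X in _ * X]big1 ?mulr1.
  by apply: eq_bigr => S _; rewrite /G eqxx.
move=> i /negbTE il; rewrite -(dM i).2; apply: eq_bigr => S _.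
by rewrite /G il mulr1.
Qed.

Lemma sum_weight : \sum_omega weight omega = 1.
Proof.
rewrite /weight -(bigA_distr_bigA (fun l => alloc M l)) big1 // => l _.
by case: (dM l).
Qed.

Variable f : {ffun 'I_k -> {set 'I_n}} -> {set 'I_m}.

Lemma sum_output_dist (F : {set 'I_m} -> R) :
  \sum_T output_dist M f T * F T = \sum_omega weight omega * F (f omega).
Proof.
rewrite (partition_big f xpredT) //=; apply: eq_bigr => T _.
by rewrite mulr_suml; apply: eq_bigr => omega /eqP->.
Qed.

Lemma is_dist_output : is_dist (output_dist M f).
Proof.
split=> [T|]; first by apply: sumr_ge0 => omega _; exact: weight_ge0.
have h := sum_output_dist (fun=> 1).
rewrite (eq_bigr (fun T => output_dist M f T * 1)) => [|T _]; last by rewrite mulr1.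
by rewrite h -[RHS]sum_weight; apply: eq_bigr => omega _; rewrite mulr1.
Qed.
End Output.
End Revenue.

(** * The instance passed to the mechanism design algorithm *)

Definition instance K m (v w : valn m) : {ffun 'I_K.+1 -> valn (K * m)} :=
  [ffun l : 'I_K.+1 => scalev (scale K.+1 (vmax v w) l) (@IT K.+1 m v w l)].

Lemma instanceE K m (v w : valn m) l S :
  instance K v w l S = scale K.+1 (vmax v w) l * @IT K.+1 m v w l S.
Proof. by rewrite /instance ffunE /scalev ffunE. Qed.

Definition nums K m (v w : valn m) (l : 'I_K.+1) := ratio_num K.+1 (vmax v w) l.
Definition dens K m (v w : valn m) (l : 'I_K.+1) := ratio_den K.+1 (vmax v w) l.

Lemma best_ge m (v w : valn m) c j : is_valuation v -> is_valuation w ->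
  w (best v w c j) <= v (best v w c j).
Proof. by move=> hv hw; elim: j => [|j IH] /=; [rewrite !valuation0 | case: ifPn => //; lia]. Qed.

Lemma best_max m (v w : valn m) c j l : l < j ->
  v (c l) + w (best v w c j) <= v (best v w c j) + w (c l).
Proof.
elim: j => // j IH; rewrite ltnS leq_eqVlt => /predU1P[->|/IH h] /=.
  by case: ifPn => //; rewrite addnC.
by case: ifPn => // h'; lia.
Qed.
Section Instance.
Variables (K m : nat) (v w : valn m).
Hypotheses (K0 : 0 < K) (m0 : 0 < m).
Hypotheses (hv : is_valuation v) (hw : is_valuation w).

Local Notation VM := (vmax v w).
Local Notation C := (scale K.+1 VM).

Let full_neq0 : ([set: 'I_m]%SET : {set 'I_m}) != finset.set0.
Proof. by apply/finset.set0Pn; exists (Ordinal m0); rewrite inE. Qed.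

Let VM0 : 0 < VM.
Proof. by rewrite /vmax leq_max (valuation_gt0 hv full_neq0). Qed.

Let v_le T : v T <= VM.
Proof. by rewrite /vmax leq_max valuation_mono //; exact: finset.subsetT. Qed.

Let w_le T : w T <= VM.
Proof.
by rewrite /vmax leq_max (valuation_mono (T := [set: 'I_m]%SET) hw) ?orbT //; exact: finset.subsetT.
Qed.

Let k1 : 1 < K.+1. Proof. by []. Qed.

Let B0 : 0 < 2 * K.+1 * VM.
Proof. by rewrite !muln_gt0 VM0. Qed.

Lemma scale_ltS l : C l < C l.+1.
Proof.
apply: leq_trans _ (scaleS_ge VM k1 l); have := scale_gt0 k1 VM0 l; have := VM0.
by move: (C l) (VM) => x y; nia.
Qed.

(** Stated over any numeric field, since the probabilities are rational and the revenue is real. *)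
Lemma ratioE (F : numFieldType) l : l < K.+1 ->
  let Q i : F := (if (i <= K)%N then (C i)%:R^-1 else 0)%R in
  ((ratio_num K.+1 VM l)%:R / (ratio_den K.+1 VM l)%:R = Q l - Q l.+1 :> F)%R.
Proof.
rewrite ltnS => lK Q; rewrite /Q lK /ratio_num /ratio_den !ltnS.
have h i : ((C i)%:R != 0 :> F)%R by rewrite pnatr_eq0 -lt0n scale_gt0.
case: ifP => lK'; last by rewrite subr0 mul1r.
rewrite natrB ?(ltnW (scale_ltS l)) // natrM.
by field; rewrite !h.
Qed.

Lemma input_bounds_instance : input_bounds v w (instance K v w) (nums v w) (dens v w).
Proof.
have CB l i : l <= i -> C l <= (2 * K.+1 * VM) ^ i.
  by move=> li; apply: leq_trans (scale_le VM k1 l) _; rewrite leq_pexp2l.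
split=> l.
  rewrite instanceE; apply: leq_trans _ (scale_mul_le k1 VM0 (ltn_ord l)).
  by rewrite leq_mul2l IT_le_vmax ?orbT.
rewrite /nums /dens /ratio_num /ratio_den; case: ifP => lK; split.
- by apply: leq_trans (leq_subr _ _) _; apply: CB; lia.
- apply: leq_trans (leq_mul (CB l l (leqnn l)) (CB l.+1 l.+1 (leqnn _))) _.
  by rewrite -expnD leq_pexp2l //; lia.
- by rewrite expn_gt0 B0.
- by apply: CB; have := ltn_ord l; lia.
Qed.

(** All items of the first copy tell the types apart: up to a common coefficient, their value is C_l
    x with 0 < x <= V, and C_l' is at least 2 V C_l for l < l'. *)
Lemma instance_injective : injective (instance K v w).
Proof.
have key (l l' : 'I_K.+1) : l < l' -> instance K v w l != instance K v w l'.
  move=> ll'; apply/eqP => /ffunP /(_ (place (Ordinal K0) [set: 'I_m]%SET)).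
  rewrite !instanceE !IT_place // => e.
  have := scale_lt k1 VM0 ll'; have := scale_gt0 k1 VM0 l.
  have h1 (b : bool) : 0 < (if b then v [set: 'I_m]%SET else w [set: 'I_m]%SET).
    by case: b; exact: valuation_gt0.
  have h2 (b : bool) : (if b then v [set: 'I_m]%SET else w [set: 'I_m]%SET) <= VM.
    by case: b.
  move: (h1 (l' <= Ordinal K0)) (h2 (l <= Ordinal K0)) e.
  move: (if _ then _ else _) (if _ then _ else _) => x y hx hy.
  rewrite /= !(mulnCA _ (K.+1 + 1)) => /eqP; rewrite eqn_pmul2l ?addn1 // => /eqP.
  move: (VM) (C l) (C l') VM0 hy => V c c' hV hy e hc hcc.
  have : c * x <= c * V by rewrite leq_mul2l hy orbT.
  have : c' * 1 <= c' * y by rewrite leq_mul2l hx orbT.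
  have : 0 < c * V by rewrite muln_gt0 hc hV.
  lia.
move=> l l' e; apply/eqP; case: (ltngtP l l') => [h|h|/val_inj->//].
  by move: (key _ _ h); rewrite e eqxx.
by move: (key _ _ h); rewrite e eqxx.
Qed.

Lemma valid_instance (V : val_class) :
  valuation_class V -> closed_scaling V -> closed_dunion V -> closed_truncation V ->
  V m v -> V m w ->
  valid_input V (instance K v w) (ratios (nums v w) (dens v w)).
Proof.
move=> HV Hs Hu Ht Vv Vw; split.
- move=> l; rewrite ffunE; apply: class_scale => //; first exact: scale_gt0.
  exact: IT_class.
- exact: instance_injective.
- move=> l; rewrite ffunE; apply: divr_gt0; rewrite ltr0n.
    by rewrite /nums /ratio_num; case: ifP => // _; rewrite subn_gt0 scale_ltS.
  rewrite /dens /ratio_den; case: ifP => _; last exact: scale_gt0.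
  by rewrite muln_gt0; apply/andP; split; exact: scale_gt0.
- pose Q i : rat := (if (i <= K)%N then (C i)%:R^-1 else 0)%R.
  (* With all prices equal to 1, summation by parts leaves Q 0 = 1. *)
  rewrite (eq_bigr (fun l : 'I_K.+1 => (Q l - Q l.+1) * 1)%R); last first.
    by move=> l _; rewrite ffunE ratioE // mulr1.
  rewrite (abel_sum Q (fun=> 1%R) K) big1 => [|i _]; last by rewrite subrr mulr0.
  by rewrite /Q ltnn /= invr1 !mulr1 addr0 subr0.
Qed.

End Instance.

(** * Quality of the reduction *)

Lemma odp_optP (R : realType) m (v w : valn m) :
  is_valuation v -> is_valuation w ->
  exists T : {set 'I_m}, [/\ odp_opt R v w = ((v T)%:R - (w T)%:R)%R, w T <= v T
    & forall T', v T' + w T <= v T + w T'].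
Proof.
move=> hv hw; pose F T : R := ((v T)%:R - (w T)%:R)%R.
have [T _ Tmax] := @Order.TotalTheory.arg_maxP _ _ _ finset.set0 xpredT F isT.
have F0 : F finset.set0 = 0%R by rewrite /F !valuation0 // subrr.
have T0 : (0 <= F T)%R by rewrite -F0; exact: Tmax.
exists T; split.
- apply/le_anti/andP; split.
    by apply/bigmax_leP; split=> // T' _; exact: Tmax.
  exact: (le_bigmax _ F T).
- by rewrite -(ler_nat R) -subr_ge0.
- move=> T'; have : (F T' <= F T)%R := Tmax T' isT; rewrite /F -(ler_nat R) !natrD; lra.
Qed.

Section Quality.
Variables (R : realType) (K m : nat) (v w : valn m).
Hypotheses (K0 : 0 < K) (m0 : 0 < m).
Hypotheses (hv : is_valuation v) (hw : is_valuation w).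

Local Notation VM := (vmax v w).
Local Notation C := (scale K.+1 VM).
Let u (l : nat) : valn (K * m) := @IT K.+1 m v w (inord l).
Let c (l : nat) := K.+1 + l.+1.

Let full_neq0 : ([set: 'I_m]%SET : {set 'I_m}) != finset.set0.
Proof. by apply/finset.set0Pn; exists (Ordinal m0); rewrite inE. Qed.

Let VM0 : 0 < VM.
Proof. by rewrite /vmax leq_max (valuation_gt0 hv full_neq0). Qed.

Let k1 : 1 < K.+1. Proof. by []. Qed.

Variable T : {set 'I_m}.
Hypothesis T_max : forall T', v T' + w T <= v T + w T'.

Definition chain_set (l : nat) : {set 'I_(K * m)} :=
  if insub l is Some i then place (i : 'I_K) T else [set: 'I_(K * m)]%SET.

Lemma chain_set_lt l (lK : l < K) : chain_set l = place (Ordinal lK) T.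
Proof. by rewrite /chain_set insubT. Qed.

Lemma chain_setK : chain_set K = [set: 'I_(K * m)]%SET.
Proof. by rewrite /chain_set insubF // ltnn. Qed.

Lemma IT_chain_set i l : i <= K -> l < K ->
  u i (chain_set l) = c l * (if i <= l then v T else w T).
Proof.
move=> iK lK; rewrite chain_set_lt /u.
have := @IT_place K.+1 m v w hv hw (inord i) (Ordinal lK) T.
by rewrite inordK.
Qed.

Lemma IT_diff_copy l S (X := copy_at m (shrink (u l) S (K * m)) l) : l < K ->
  u l S + c l * w X <= u l.+1 S + c l * v X.
Proof.
move=> lK; have lK' : l < K.+1 by exact: ltnW.
have e : (inord l.+1 : 'I_K.+1) = (inord l : 'I_K.+1).+1 :> nat by rewrite !inordK.
have := @IT_diff K.+1 m v w (inord l) (inord l.+1) S e; set Y := copy_at _ _ _.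
by rewrite /Y /= inordK.
Qed.

Lemma IT_diff_opt l S : l < K ->
  u l S + c l * w T <= u l.+1 S + c l * v T.
Proof.
move=> lK; have := IT_diff_copy S lK; set X := copy_at _ _ _ => h.
have : c l * (v X + w T) <= c l * (v T + w X) by rewrite leq_mul2l T_max orbT.
move: h; rewrite !mulnDr; lia.
Qed.

Lemma IT_le_full l S : u l S <= u l [set: 'I_(K * m)]%SET.
Proof.
have h := @is_valuation_IT K.+1 m v w hv hw (inord l) m0.
by apply: (valuation_mono h); exact: finset.subsetT.
Qed.

(** * Local incentive constraints of the optimal menu *)

Section Positive.
Hypothesis wT : 0 < w T.
Hypothesis wvT : w T <= v T.

Let vVM : v T <= VM.
Proof. by rewrite /vmax leq_max (valuation_mono (T := [set: 'I_m]%SET) hv) //; exact: finset.subsetT. Qed.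

(** From type i to i + 1 the value of T in copy i drops from v(T) to w(T) >= 1, but the ratio 2 V of
    the factors outweighs v(T) <= V. *)
Lemma chain_local_ge0 i : i < K ->
  C i * u i (chain_set i) <= C i.+1 * u i.+1 (chain_set i).
Proof.
move=> iK; rewrite !IT_chain_set ?(ltnW iK) // leqnn ltnn.
rewrite !(mulnCA _ (c i)) leq_mul2l; apply/orP; right.
apply: leq_trans (leq_mul (scaleS_ge VM k1 i) wT); rewrite muln1.
rewrite (mulnC _ (C i)) leq_mul2l; apply/orP; right; lia.
Qed.

(** Here i > 0, so the ratio of the factors is 2 k V. As c_i exceeds c_l by at least 1, the gain is
    at least C_i 2 k V w(T), which covers C_i c_i v(T) because c_i <= 2 k. *)
Lemma chain_local_lt i l : i < K -> l < i ->
  C i.+1 * u i.+1 (chain_set l) + C i * u i (chain_set i) <=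
  C i.+1 * u i.+1 (chain_set i) + C i * u i (chain_set l).
Proof.
move=> iK li; have lK := ltn_trans li iK.
have e1 : (i < l) = false by lia.
have e2 : (i <= l) = false by lia.
rewrite !IT_chain_set ?(ltnW iK) // leqnn ltnn e1 e2.
rewrite scaleS; last exact: leq_ltn_trans li.
have h1 : c l + 1 <= c i by rewrite /c; lia.
have h2 : c i * v T <= 2 * K.+1 * VM by apply: leq_mul => //; rewrite /c; lia.
move: (2 * K.+1 * VM) (C i) h2 => B x h2.
have h3 : x * (c i * v T) <= x * B by rewrite leq_mul2l h2 orbT.
have h4 : x * B * 1 <= x * B * w T by rewrite leq_mul2l wT orbT.
have h5 : x * B * w T * (c l + 1) <= x * B * w T * c i by rewrite leq_mul2l h1 orbT.
move: h3 h4 h5; move: (c i) (c l) (v T) (w T) => *; nia.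
Qed.

(** Let x and y be the unscaled values of the offer to l for types i and i + 1. By [IT_diff_opt], x
    - y is at most c_i (v(T) - w(T)), and y is at least c_i w(T); weighting the excess of y by
    C_(i+1) >= C_i only helps. *)
Lemma chain_local_gt i l : i < l <= K ->
  C i.+1 * u i.+1 (chain_set i) + C i * u i (chain_set l) <=
  C i.+1 * u i.+1 (chain_set l) + C i * u i (chain_set i).
Proof.
case/andP=> il lK; have iK := leq_trans il lK.
have key x y : u i.+1 (chain_set i) <= y -> x + c i * w T <= y + c i * v T ->
    C i.+1 * u i.+1 (chain_set i) + C i * x <= C i.+1 * y + C i * u i (chain_set i).
  rewrite !IT_chain_set ?(ltnW iK) // leqnn ltnn => h1 h2.
  have : C i <= C i.+1 by apply: ltnW; exact: scale_ltS.
  move: (C i) (C i.+1) (c i * w T) (c i * v T) h1 h2 => a b p q h1 h2 ab.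
  have h3 : a * (y - p) <= b * (y - p) by rewrite leq_mul2r ab orbT.
  have h4 : a * (x + p) <= a * (y + q) by rewrite leq_mul2l h2 orbT.
  have h5 : b * y = b * (y - p) + b * p by rewrite -mulnDr subnK.
  have h6 : a * y = a * (y - p) + a * p by rewrite -mulnDr subnK.
  move: (y - p) h3 h5 h6 => d; nia.
apply: key; last exact: IT_diff_opt.
have [lK'|Kl] := ltnP l K; last first.
  have -> : l = K by lia.
  by rewrite chain_setK; exact: IT_le_full.
rewrite !IT_chain_set // ltnn il; apply: leq_mul => //; rewrite /c; lia.
Qed.
End Positive.

Local Open Scope ring_scope.
Local Notation z := (instance K v w).
Local Notation q := (ratios (nums v w) (dens v w)).

Lemma ratr_ratios (l : 'I_K.+1) (Q := fun i => if (i <= K)%N then (C i)%:R^-1 else 0) :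
  ratr (q l) = Q l - Q l.+1 :> R.
Proof. by rewrite ffunE fmorph_div !rmorph_nat; exact: ratioE. Qed.

Lemma instance_inord (l : 'I_K.+1) S : z l S = (C l * u l S)%N.
Proof. by rewrite instanceE /u inord_val. Qed.

Lemma revenue_instance_le (M : menu R (K * m) K.+1) : feasible z M -> revenue q M <=
  \sum_(l < K) (ev (u l) (alloc M (inord l)) - ev (u l.+1) (alloc M (inord l)))
  + (u K [set: 'I_(K * m)]%SET)%:R.
Proof.
move=> fM; have := revenue_le (scale_gt0 k1 VM0) instance_inord ratr_ratios fM.
move=> /le_trans; apply; rewrite lerD2l; apply: ler_ev_const => [|S]; last exact: IT_le_full.
by case: fM.
Qed.

Lemma ev_diff_le (p : {set 'I_(K * m)} -> R) l : (l < K)%N -> is_dist p ->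
  ev (u l) p - ev (u l.+1) p <=
  (c l)%:R * \sum_S p S * ((v (copy_at m (shrink (u l) S (K * m)) l))%:R
                           - (w (copy_at m (shrink (u l) S (K * m)) l))%:R).
Proof.
move=> lK [p0 _]; rewrite /ev -sumrB mulr_sumr; apply: ler_sum => S _.
rewrite -mulrBr mulrCA; apply: ler_wpM2l => //.
have := IT_diff_copy S lK; cbv zeta; move: (c l) => a; rewrite -(ler_nat R) !natrD !natrM mulrBr; lra.
Qed.

Lemma ev_diff_opt_le (p : {set 'I_(K * m)} -> R) l : (l < K)%N -> is_dist p ->
  ev (u l) p - ev (u l.+1) p <= (c l)%:R * ((v T)%:R - (w T)%:R).
Proof.
move=> lK pd; apply: le_trans (ev_diff_le lK pd) _; apply: ler_wpM2l => //.
case: pd => p0 p1; rewrite -[leRHS]mul1r -[X in _ <= X * _]p1 mulr_suml.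
apply: ler_sum => S _; apply: ler_wpM2l => //.
have := T_max (copy_at m (shrink (u l) S (K * m)) l).
by rewrite -(ler_nat R) !natrD; lra.
Qed.

Lemma menu_instance_ex : (0 < w T)%N -> (w T <= v T)%N ->
  exists M : menu R (K * m) K.+1, feasible z M /\
    revenue q M = \sum_(l < K) (c l)%:R * ((v T)%:R - (w T)%:R)
                  + (u K [set: 'I_(K * m)]%SET)%:R.
Proof.
move=> wT wvT.
have [|||M [fM rM]] := @revenue_chain_ex R _ _ z u C q (scale_gt0 k1 VM0) instance_inord
  ratr_ratios chain_set.
- by move=> i iK; rewrite subr_ge0 ler_nat chain_local_ge0.
- move=> i l iK li; have := chain_local_lt wT wvT iK li.
  by rewrite -(ler_nat R) !natrD; lra.
- move=> i l il; have := chain_local_gt wT wvT il.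
  by rewrite -(ler_nat R) !natrD; lra.
exists M; split=> //; rewrite rM chain_setK; congr (_ + _); apply: eq_bigr => l _.
rewrite !IT_chain_set //; last exact: ltnW.
by rewrite leqnn ltnn !natrM mulrBr.
Qed.

(** Each coefficient is at least k, which cancels the factor k in [IT_last_le_full]. *)
Lemma sum_c_ge : (K * K.+1)%:R <= \sum_(l < K) (c l)%:R :> R.
Proof.
rewrite -natr_sum ler_nat -[X in (X * _)%N](card_ord K) -sum_nat_const.
by apply: leq_sum => l _; rewrite /c leq_addr.
Qed.

Lemma IT_last_le_full : (u K [set: 'I_(K * m)]%SET)%:R <=
  (2 * K.+1 * m * w [set: 'I_m]%SET)%:R :> R.
Proof. by rewrite ler_nat; apply: (@IT_last_le K.+1 m v w hw); rewrite inordK. Qed.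
End Quality.

(** * From the revenue guarantee to the approximation factor *)

Section Conclusion.
Variables (R : realType) (K m : nat) (v w : valn m).
Hypotheses (K0 : (0 < K)%N) (m0 : (0 < m)%N).
Hypotheses (hv : is_valuation v) (hw : is_valuation w).
Local Open Scope ring_scope.
Local Notation z := (instance K v w).
Local Notation q := (ratios (nums v w) (dens v w)).

Lemma reduction_quality (alpha : R) (M : menu R (K * m) K.+1)
    (f : {ffun 'I_K.+1 -> {set 'I_(K * m)}} -> {set 'I_m}) :
  mdmdp_approx alpha z q M ->
  (forall omega, f omega = best v w (candidate v w omega) K) ->
  odp_approx (quality alpha K.+1 w) v w (output_dist M f).
Proof.
move=> [fM hM] fE; have [dM _ _] := fM; split; first exact: is_dist_output.
have [T [-> wvT T_max]] := odp_optP R hv hw.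
set EX := (X in _ <= X); pose wt (omega : {ffun 'I_K.+1 -> {set 'I_(K * m)}}) := \prod_l alloc M l (omega l).
have wt0 omega : 0 <= wt omega by exact: weight_ge0.
have EXE : EX = \sum_omega wt omega * ((v (f omega))%:R - (w (f omega))%:R).
  rewrite /EX /ev -sumrB -(sum_output_dist M f (fun T => (v T)%:R - (w T)%:R)).
  by apply: eq_bigr => S _; rewrite mulrBr.
have EX0 : 0 <= EX.
  rewrite EXE; apply: sumr_ge0 => omega _; rewrite mulr_ge0 // subr_ge0 ler_nat fE.
  exact: best_ge.
have hK : (0 : R) < K%:R by rewrite ltr0n.
have w1 : (0 : R) <= (m * w [set: 'I_m]%SET)%:R by rewrite ler0n.
rewrite /quality; set D := (1 - alpha) * _ * _ * _ / _.
have DE : D * K%:R = (1 - alpha) * 2 * (m * w [set: 'I_m]%SET)%:R.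
  have -> : D = (1 - alpha) * 2 * (m * w [set: 'I_m]%SET)%:R / K%:R.
    by rewrite /D -[K.+1]addn1 natrD addrK natrM -!mulrA.
  by rewrite divfK // gt_eqF.
(* If the optimum is 0, a non-negative expected difference is all that is asked. *)
have [lt|] := ltnP (w T) (v T); last first.
  move=> le; have -> : (v T)%:R - (w T)%:R = 0 :> R by apply/eqP; rewrite subr_eq0 eqr_nat eqn_leq le wvT.
  by rewrite mulr0.
have wT : (0 < w T)%N.
  apply: valuation_gt0 => //; apply/eqP => T0.
  by move: lt; rewrite T0 !valuation0.
set X : R := (v T)%:R - (w T)%:R.
(* Values are integers, so a positive optimum is at least 1; this turns the additive loss into a
   multiplicative one. *)
have X1 : 1 <= X by rewrite /X lerBrDr -(natrD R 1) ler_nat.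
pose c l : R := (K.+1 + l.+1)%:R.
pose L : R := (@IT K.+1 m v w (inord K) [set: 'I_(K * m)]%SET)%:R.
pose Sc : R := \sum_(l < K) c l.
have ScK : K%:R * K.+1%:R <= Sc by rewrite -natrM; exact: sum_c_ge.
have LK : L <= 2 * K.+1%:R * (m * w [set: 'I_m]%SET)%:R.
  by apply: le_trans (IT_last_le_full R K v hw) _; rewrite -!natrM !mulnA.
have L0 : 0 <= L by rewrite ler0n.
have hrev : revenue q M <= Sc * EX + L.
  apply: le_trans (revenue_instance_le K0 m0 hv hw fM) _.
  rewrite lerD2r mulr_suml; apply: ler_sum => l _.
  have lK : (l < K)%N by [].
  apply: le_trans (ev_diff_le v w lK (dM _)) _.
  (* The l-th term depends on the l-th draw only. Written over all draws, it is bounded pointwise,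
     as the returned set beats the l-th candidate. *)
  apply: ler_wpM2l => //; rewrite EXE -(sum_weight_marginal dM).
  apply: ler_sum => omega _; apply: ler_wpM2l; [exact: wt0 | rewrite fE].
  have := best_max v w (candidate v w omega) lK.
  by rewrite -(ler_nat R) !natrD /candidate; lra.
have hOPT (M' : menu R (K * m) K.+1) : feasible z M' -> revenue q M' <= Sc * X + L.
  move=> fM'; apply: le_trans (revenue_instance_le K0 m0 hv hw fM') _.
  rewrite lerD2r mulr_suml; apply: ler_sum => l _.
  by apply: (ev_diff_opt_le T_max (ltn_ord l)); case: fM'.
have [M0 [fM0 revM0]] := menu_instance_ex R K0 m0 hv hw T_max wT wvT.
have OPTge : Sc * X + L <= OPT R z q.
  apply: le_trans (revenue_le_OPT hOPT fM0).
  by rewrite revM0 mulr_suml.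
have Sc0 : 0 < Sc by apply: lt_le_trans ScK; rewrite mulr_gt0 ?ltr0n.
have OPT0 : 0 < OPT R z q.
  by apply: lt_le_trans OPTge; rewrite ltr_wpDr // mulr_gt0 // (lt_le_trans _ X1).
(* Otherwise the menu returned by the algorithm would earn more than the positive optimum. *)
have a1 : alpha <= 1.
  rewrite leNgt; apply/negP => a1; have := revenue_le_OPT hOPT fM; nra.
have D0 : 0 <= D by rewrite -(pmulr_lge0 _ hK) DE !mulr_ge0 // subr_ge0.
(* A lower bound on [OPT] can be multiplied by alpha only if alpha >= 0; for negative alpha the
   claimed factor is negative and [EX0] suffices. *)
have [aneg|a0] := ltP alpha 0.
  by apply: le_trans EX0; nra.
have h1 : alpha * (Sc * X + L) <= Sc * EX + L.
  apply: le_trans hrev; apply: le_trans hM; exact: ler_wpM2l.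
have h2 : (1 - alpha) * L <= D * Sc.
  apply: (@le_trans _ _ (D * (K%:R * K.+1%:R))); last exact: ler_wpM2l.
  rewrite mulrA DE -!mulrA; apply: ler_wpM2l; first by rewrite subr_ge0.
  by apply: le_trans LK _; rewrite -mulrA [_ * K.+1%:R]mulrC.
(* After multiplication by Sc, the loss (1 - alpha) L in [h1] is at most D Sc by [h2], and this is
   at most D Sc X. *)
rewrite -(ler_pM2l Sc0).
have h3 : D * Sc * 1 <= D * Sc * X by rewrite ler_wpM2l // mulr_ge0 // ltW.
nra.
Qed.
End Conclusion.

(** * Assembly of the two reductions *)

Lemma simulates_oracle_time e c k m (v w : valn m) psim :
  fits e k v w -> k * m < base e ->
  (forall (l : 'I_k) (S : {set 'I_(k.-1 * m)}),
     let o := run (oracles v w) psim (enc_seq [:: Leaf k; Leaf m; Leaf l; enc_set S]) in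
     res o = Leaf (IT v w l S) /\ oracle_time c k v w o) ->
  simulates e k v w psim (2 * c).
Proof.
move=> [ho _ _ _ hV] hkm H l S; have [r t] := H l S.
have {}t := cost_of_budget hkm hV t.
have wd : bits (Leaf (IT v w l S)) <= base e ^ (2 * c) * wid e.
  by rewrite -r; apply: leq_trans (bits_res_width _ _ _) _; case: t.
by split; rewrite ?ho.
Qed.

Lemma deep_arg e k m (v w : valn m) rest : fits e k v w -> deep e 2 rest ->
  deep e 2 (Node (Leaf k) (Node (Leaf m) rest)).
Proof.
move=> [_ hk hm _ _] hr; apply/and3P; split=> //; apply: deep_leaf_leq; exact: leq_base1.
Qed.

Lemma oracle_reduction_correct (R : realType) (V : val_class) :
  valuation_class V -> closed_scaling V -> closed_dunion V -> closed_truncation V ->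
  query_simulation V ->
  exists (c : nat) (pre ora post : prog),
     forall (alpha : R) (A : oracle_solver R), oracle_approx V alpha A ->
     forall (k m : nat) (v w : valn m), 1 < k -> 0 < m -> V m v -> V m w ->
       oracle_reduction V c pre ora post alpha A k v w.
Proof.
move=> HV Hs Hu Ht [c0 [psim Hsim]].
have [c1 H1] := exec_pratios 2.
(* The depth covers both the input, of depth 2, and the prepared data, of depth (c1 + 1) + 1. *)
have [c2 H2] := exec_pvalue psim (2 * c0) ((c1 + 1).+1 + 2).
have [c3 H3] := exec_pfinish psim (2 * c0) ((c1 + 1).+1 + 2).
exists (c1 + c2 + c3 + 3), (Pair pratios (Lit 0)), (pvalue psim), (pfinish psim).
move=> alpha A HA [|[|K']] // m v w _ m0 Vv Vw; set K := K'.+1.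
have [hv hw] := (HV _ _ Vv, HV _ _ Vw).
have [e [hf be we]] := oracle_setting (isT : 1 < K.+1) m0 hv hw.
have hsim : simulates e K.+1 v w psim (2 * c0).
  by apply: simulates_oracle_time => // [|l S]; [rewrite be | exact: Hsim].
have ho : oracles v w = orc e by case: hf.
have time c o : c < c1 + c2 + c3 + 3 -> cost e c o -> oracle_time (c1 + c2 + c3 + 3) K.+1 v w o.
  by move=> hc; rewrite /oracle_time -we; exact: budget_of_cost.
have Dx := deep_arg hf (deep_bool e 2 false).
have [ry ty Dy] := exec_Pair (H1 e K.+1 m v w (Leaf 0) hf Dx) (exec_Lit e 0 _).
have {}Dx := deep_leq (leq_addl (c1 + 1).+1 2) Dx.
have {}Dy := deep_leq (leq_addr 2 _) Dy.
rewrite /oracle_reduction ho.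
split; first by apply: time ty; lia.
exists (instance K v w), (nums v w), (dens v w); rewrite ry; split.
- by [].
- move=> l S; have [r t _] := H2 e K.+1 m v w (Leaf 0) _ l S hf hsim Dx Dy.
  by rewrite r instanceE; split=> //; apply: time t; lia.
- exact: valid_instance.
- exact: input_bounds_instance.
- split=> [omega|].
    by have [_ t _] := H3 e K m v w (Leaf 0) _ omega hf hsim Dx Dy; apply: time t; lia.
  apply: reduction_quality => //; first by apply: HA; exact: valid_instance.
  move=> omega; rewrite /finish.
  by have [-> _ _] := H3 e K m v w (Leaf 0) _ omega hf hsim Dx Dy; rewrite enc_setK.
Qed.

Lemma computes_leq n (v : valn n) d s s' : s <= s' -> computes d v s -> computes d v s'.
Proof.
move=> ss' [p [dE ps H]]; exists p; split=> //; first exact: leq_trans ps ss'.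
by move=> S; have [r t wd] := H S; split=> //; [exact: leq_trans t ss' | exact: leq_trans wd ss'].
Qed.

(** The reduction evaluates the list by query simulation here as well; the written codes are only
    multiplied by their factors and passed on. *)
Lemma explicit_reduction_correct (R : realType) (V : val_class) :
  valuation_class V -> closed_scaling V -> closed_dunion V -> closed_truncation V ->
  query_sufficient V ->
  exists (c : nat) (pre post : prog),
     forall (alpha : R) (A : explicit_solver R), explicit_approx V alpha A ->
     forall (k m s : nat) (v w : valn m) (dv dw : tree),
       1 < k -> 0 < m -> V m v -> V m w ->
       computes dv v s -> computes dw w s ->
       explicit_reduction V c pre post alpha A k s v w dv dw.
Proof.
move=> HV Hs Hu Ht [[c0 [psim Hsim]] [c4 [pcode Hcode]]].
have [c1 H1] := exec_pratios 2.
have [c2 H2] := exec_pcodes pcode (2 * c4).+2 2.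
have [c3 H3] := exec_pfinish psim (2 * c0) ((c1 + (c2 + 1).+1).+1 + 2).
pose c := c1 + c2 + c3 + 2 * c4 + 9.
exists c, (Pair pratios (Pair (pcodes pcode) (Lit 0))), (pfinish psim).
move=> alpha A HA [|[|K']] // m s v w dv dw _ m0 Vv Vw cv cw; set K := K'.+1.
have [hv hw] := (HV _ _ Vv, HV _ _ Vw).
have [e [hf be we]] := explicit_setting (isT : 1 < K.+1) m0 hv hw cv cw.
have s0 : 0 < s by rewrite -we wid_gt0.
have sN : s <= K.+1 * m * s by rewrite leq_pmull // muln_gt0.
have hsim : simulates e K.+1 v w psim (2 * c0).
  apply: simulates_oracle_time => // [|l S]; last exact: Hsim.
  by rewrite be ltnS leq_pmulr.
have ho : oracles v w = orc e by case: hf.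
have time c' o : c' < c -> cost e c' o -> explicit_time c K.+1 m s o.
  by move=> hc; apply: budget_of_cost_wid => //; rewrite we be; exact: leqW.
have Dd n (u : valn n) d : computes d u s -> deep e 2 d.
  move=> cd; apply: deep_computes cd _ => //.
  by rewrite we leq_pmull // base_exp_gt0.
pose x := enc_seq [:: Leaf K.+1; Leaf m; dv; dw].
have Dx : deep e 2 x.
  apply: (deep_arg hf); apply/and3P; split; [exact: Dd cv | exact: Dd cw | exact: (deep_bool e 2 false)].
have [tcode [d [rcode dP]]] := Hcode K.+1 m s v w dv dw isT m0 Vv Vw cv cw.
(* Raising the exponent by 2 meets the side condition 1 < c of [deep_computes], even for c4 = 0. *)
have Ecode : exec e (2 * c4).+2 pcode x (enc_seq [seq d l | l <- enum 'I_K.+1]).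
  split; rewrite -?ho //.
    apply: (@cost_leq _ (2 * c4)); first by lia.
    by apply: (@cost_of_budget e c4 (K.+1 * m * s) 1); rewrite ?be ?wid_gt0 ?muln1.
  apply: deep_enc_seq => l _; apply: (deep_computes _ (dP l)) => //.
  have := @poly_bound_leq e c4 (K.+1 * m * s); rewrite be ltnSn => /(_ isT) h.
  apply: leq_trans h _; rewrite -be; apply: leq_trans (leq_pmulr _ (wid_gt0 e)).
  by apply: base_exp_leq; lia.
have E2 := H2 e K.+1 m v w _ d hf Dx Ecode.
have [ry ty Dy] := exec_Pair (H1 e K.+1 m v w _ hf Dx) (exec_Pair E2 (exec_Lit e 0 _)).
have {}Dx := deep_leq (leq_addl (c1 + (c2 + 1).+1).+1 2) Dx.
have {}Dy := deep_leq (leq_addr 2 _) Dy.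
pose d' : {ffun 'I_K.+1 -> tree} := [ffun l : 'I_K.+1 => scaled_code (scale K.+1 (vmax v w) l) (d l)].
have cd' l : computes (d' l) (instance K v w l) (poly_bound c (K.+1 * m * s)).
  rewrite ffunE; apply: computes_leq (computes_scaled (dP l) (fun S => instanceE v w l S)).
  have [_ hk _ _ hV] := hf.
  have h1 := deep_scale hk hV (ltnW (ltn_ord l)).
  have h2 : base e ^ 4 * wid e <= base e ^ (5 + 2 * c4).
    apply: (@leq_trans (base e ^ 5)); last by apply: base_exp_leq; lia.
    by rewrite (expnSr _ 4) leq_mul2l we be (leqW sN) orbT.
  have := @poly_bound_leq e c4 (K.+1 * m * s); rewrite be ltnSn => /(_ isT) h3.
  have h4 : base e ^ (2 * c4) <= base e ^ (5 + 2 * c4) by apply: base_exp_leq; lia.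
  have h5 := base_expS e (5 + 2 * c4); have h6 := base_expS e (5 + 2 * c4).+1.
  have h7 := base_exp_gt0 e (5 + 2 * c4).
  apply: (@leq_trans (base e ^ (5 + 2 * c4).+2)).
    by move: h1 h3; rewrite -be /=; lia.
  rewrite /poly_bound -be; apply: (@leq_trans (base e ^ c)); first by apply: base_exp_leq; rewrite /c; lia.
  by rewrite leq_pmull // /c; lia.
rewrite /explicit_reduction -/x ho.
split; first by apply: time ty; rewrite /c; lia.
exists (instance K v w), d', (nums v w), (dens v w); rewrite ry; split.
- by split=> //=; congr enc_seq; apply: eq_map => l; rewrite ffunE.
- exact: cd'.
- exact: valid_instance.
- exact: input_bounds_instance.
- split=> [omega|].
    by have [_ t _] := H3 e K m v w _ _ omega hf hsim Dx Dy; apply: time t; rewrite /c; lia.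
  apply: reduction_quality => //.
    by apply: HA; [exact: valid_instance | move=> l; eexists; exact: cd'].
  move=> omega; rewrite /finish.
  by have [-> _ _] := H3 e K m v w _ _ omega hf hsim Dx Dy; rewrite enc_setK.
Qed.

Theorem theorem11 (R : realType) (V : val_class)
    (HV : valuation_class V)
    (Hscale : closed_scaling V)
    (Hunion : closed_dunion V)
    (Htrunc : closed_truncation V)
    (Hsuff : query_sufficient V) :
  (exists (c : nat) (pre ora post : prog),
     forall (alpha : R) (A : oracle_solver R), oracle_approx V alpha A ->
     forall (k m : nat) (v w : valn m), 1 < k -> 0 < m -> V m v -> V m w ->
       oracle_reduction V c pre ora post alpha A k v w)
  /\
  (exists (c : nat) (pre post : prog),
     forall (alpha : R) (A : explicit_solver R), explicit_approx V alpha A ->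
     forall (k m s : nat) (v w : valn m) (dv dw : tree),
       1 < k -> 0 < m -> V m v -> V m w ->
       computes dv v s -> computes dw w s ->
       explicit_reduction V c pre post alpha A k s v w dv dw).
Proof.
split; last exact: explicit_reduction_correct.
by case: Hsuff => Hsim _; exact: oracle_reduction_correct.
Qed.
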